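(* Let $N\ge1$ be an integer, $\alpha>0$, and let $\Omega\subset\mathbb R^N$ be a domain (not necessarily bounded, with sufficiently smooth boundary if $\partial\Omega\ne\emptyset$). Let $\varphi\in L^\infty(\Omega)$, $\varphi\ge0$, $\varphi\not\equiv0$. Then the existence time $T_{\max}(\lambda\varphi)$ of the maximal solution of $\partial_tu=\Delta u+|u|^\alpha u$ in $\Omega$ with Dirichlet boundary conditions and $u(0)=\lambda\varphi$ satisfies $T_{\max}(\lambda\varphi)<\infty$ for $\lambda>0$ sufficiently large and $$\limsup_{\lambda\to\infty}\lambda^\alpha\,T_{\max}(\lambda\varphi)\ \le\ \frac1{\alpha\|\varphi\|_\infty^\alpha} .$$
   Context: $\|\cdot\|_\infty$ is the $L^\infty(\Omega)$ norm and $e^{t\Delta}$ is the Dirichlet heat semigroup on $\Omega$. For $u_0\ge0$, $T_{\max}(u_0)\in[0,\infty]$ is the maximal existence time of a nonnegative solution of $$u(t)=e^{t\Delta}u_0+\int_0^te^{(t-\sigma)\Delta}\big[|u(\sigma)|^\alpha u(\sigma)\big]\,d\sigma ,$$ i.e. the supremum of the $T>0$ for which there is a nonnegative, a.e. finite measurable function $u$ on $(0,T)\times\Omega$ satisfying this integral equation. An upper bound for this quantity is also an upper bound for the maximal existence time of the regular (bounded) nonnegative solution. *)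

(* Defs.v *)
From HB Require Import structures.
From mathcomp Require Import all_boot all_order all_algebra.
From mathcomp Require Import all_classical all_reals all_analysis.
From mathcomp Require Import measurable_realfun ess_sup_inf.
Set Implicit Arguments.
Unset Strict Implicit.
Unset Printing Implicit Defensive.
Import Order.TTheory GRing.Theory Num.Theory.
Import numFieldNormedType.Exports.
Local Open Scope classical_set_scope.
Local Open Scope ring_scope.

(* R^n is ['rV[R]_n].  The library gives it a topology but no sigma-algebra;
   the one generated by the coordinates below is the Borel sigma-algebra. *)

Fact rV_display : measure_display.
Proof. exact: default_measure_display. Qed.

Section measurable_rV.
Context (R : realType) (n : nat).

Definition rV_coord (i : 'I_n) (v : 'rV[R]_n) : measurableTypeR R := v ord0 i.

Let rV_set0 : g_sigma_preimage rV_coord set0.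
Proof. exact: sigma_algebra0. Qed.

Let rV_setC A : g_sigma_preimage rV_coord A -> g_sigma_preimage rV_coord (~` A).
Proof. exact: sigma_algebraC. Qed.

Let rV_bigcup (F : _^nat) : (forall i, g_sigma_preimage rV_coord (F i)) ->
  g_sigma_preimage rV_coord (\bigcup_i (F i)).
Proof. exact: sigma_algebra_bigcup. Qed.

HB.instance Definition _ := @isMeasurable.Build rV_display
  'rV[R]_n (g_sigma_preimage rV_coord) rV_set0 rV_setC rV_bigcup.

Lemma measurable_rV_coord (i : 'I_n) :
  measurable_fun [set: 'rV[R]_n] (rV_coord i).
Proof.
move=> _ Y mY; rewrite setTI; apply: sub_sigma_algebra => /=.
rewrite -bigcup_seq/=; exists i => /=; first by rewrite mem_index_enum.
by exists Y => //; rewrite setTI.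
Qed.

Lemma measurable_fun_rVP d (T : measurableType d) (f : T -> 'rV[R]_n) :
  (forall i, measurable_fun [set: T] (rV_coord i \o f)) ->
  measurable_fun [set: T] f.
Proof.
move=> mf _ A mA; rewrite setTI.
have sF : sigma_algebra [set: 'rV[R]_n]
    [set B | measurable (f @^-1` B)].
  split => [|B mB|F mF] /=; first by rewrite preimage_set0.
  - by rewrite setTD preimage_setC; exact: measurableC.
  - by rewrite preimage_bigcup; apply: bigcup_measurable => k _; exact: mF.
apply: (mA [set B | measurable (f @^-1` B)]); split=> // B.
rewrite -bigcup_seq => -[i _ [C mC <-]] /=; rewrite setTI -comp_preimage.
by rewrite -[X in measurable X]setTI; exact: mf.
Qed.

End measurable_rV.

Section lebesgue_rV.
Context (R : realType).

Definition rV_cons n (p : measurableTypeR R * 'rV[R]_n) : 'rV[R]_n.+1 :=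
  row_mx (p.1%:M : 'M[R]_1) p.2.

Definition rV_uncons n (v : 'rV[R]_n.+1) : measurableTypeR R * 'rV[R]_n :=
  (v ord0 ord0, rsubmx (v : 'rV[R]_(1 + n))).

Lemma rV_consK n : cancel (@rV_cons n) (@rV_uncons n).
Proof.
move=> [x v]; rewrite /rV_uncons /rV_cons/=; congr pair; last exact: row_mxKr.
transitivity (row_mx (x%:M : 'M[R]_1) v ord0 (lshift n ord0)).
  by congr fun_of_matrix; exact: val_inj.
by rewrite row_mxEl mxE eqxx.
Qed.

Lemma measurable_rV_cons n : measurable_fun setT (@rV_cons n).
Proof.
apply: measurable_fun_rVP => i.
case: (split_ordP (i : 'I_(1 + n))) => j ->.
  rewrite (_ : _ \o _ = fst) //; apply/funext => -[x v].
  by apply: etrans (row_mxEl _ _ _ _) _; rewrite mxE !ord1 eqxx.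
rewrite (_ : _ \o _ = rV_coord j \o snd); last first.
  by apply/funext => -[x v]; apply: etrans (row_mxEr _ _ _ _) _.
by apply: measurableT_comp => //; exact: measurable_rV_coord.
Qed.

Lemma measurable_rV_uncons n : measurable_fun setT (@rV_uncons n).
Proof.
apply/measurable_fun_pairP; split; first exact: (measurable_rV_coord ord0).
apply: measurable_fun_rVP => i.
rewrite (_ : _ \o _ = rV_coord (rshift 1 i : 'I_n.+1)).
  exact: measurable_rV_coord.
by apply/funext => v; rewrite /= /rV_coord mxE.
Qed.

Section rV_product.
Context n (mu : {sigma_finite_measure set 'rV[R]_n -> \bar R}).

Definition rV_product : set 'rV[R]_n.+1 -> \bar R :=
  pushforward (@lebesgue_measure R \x mu)%E (@rV_cons n).

Let rV_product0 : rV_product set0 = 0%E.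
Proof. by rewrite /rV_product /pushforward preimage_set0 measure0. Qed.

Let rV_product_ge0 A : (0 <= rV_product A)%E.
Proof. by rewrite /rV_product /pushforward; exact: measure_ge0. Qed.

Let rV_product_sigma_additive : semi_sigma_additive rV_product.
Proof.
exact: (@measure_semi_sigma_additive _ _ _
  (measure_function_pushforward__canonical__measure_function_Measure
    (@lebesgue_measure R \x mu)%E (@measurable_rV_cons n))).
Qed.

HB.instance Definition _ := isMeasure.Build _ _ _
  rV_product rV_product0 rV_product_ge0 rV_product_sigma_additive.

Let rV_product_sigma_finite : sigma_finite setT rV_product.
Proof.
have /sigma_finiteP[G [GT ndG Goo]] := sigma_finiteT mu.
have /sigma_finiteP[H [HT ndH Hoo]] := sigma_finiteT (@lebesgue_measure R).
exists (fun k => @rV_uncons n @^-1` (H k `*` G k)).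
  apply/esym; rewrite -subTset => v _; rewrite -preimage_bigcup /=.
  have [k _ Hk] : (\bigcup_k H k) (rV_uncons v).1 by rewrite -HT.
  have [l _ Gl] : (\bigcup_k G k) (rV_uncons v).2 by rewrite -GT.
  exists (maxn k l) => //; split.
  - by move: Hk; exact/subsetPset/ndH/leq_maxl.
  - by move: Gl; exact/subsetPset/ndG/leq_maxr.
move=> k; have [mH Hk] := Hoo k; have [mG Gk] := Goo k; split.
  rewrite -[X in measurable X]setTI.
  by apply: measurable_rV_uncons => //; exact: measurableX.
rewrite /rV_product /pushforward -comp_preimage.
rewrite (_ : _ \o _ = id); last by apply/funext => p; exact: rV_consK.
by rewrite preimage_id product_measure1E// lte_mul_pinfty// ge0_fin_numE.
Qed.

HB.instance Definition _ := Measure_isSigmaFinite.Build _ _ _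
  rV_product rV_product_sigma_finite.

End rV_product.

(* The Lebesgue measure of R^n, as the n-fold product of the one of R. *)
Fixpoint lebesgue_rV (n : nat) : {sigma_finite_measure set 'rV[R]_n -> \bar R} :=
  match n with
  | 0 => dirac (0 : 'rV[R]_0)
  | m.+1 => rV_product (lebesgue_rV m)
  end.

End lebesgue_rV.

Section domains.
Context (R : realType) (N : nat).
Implicit Types (Omega : set 'rV[R]_N) (x : 'rV[R]_N).

Definition unit_rV (i : 'I_N) : 'rV[R]_N := delta_mx ord0 i.

Definition domain Omega := [/\ open Omega, connected Omega & Omega !=set0].

(* The boundary of the open set [Omega]. *)
Definition boundary Omega := closure Omega `\` Omega.

(* [Omega] is of class C^1: near each boundary point it is the sublevel set of
   a C^1 function with nonzero gradient, hence lies locally on one side of its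
   boundary.  C^1 is the weakest reading of "sufficiently smooth". *)
Definition C1_boundary Omega :=
  forall z, boundary Omega z ->
  exists (U : set 'rV[R]_N) (rho : 'rV[R]_N -> R),
    [/\ open U, U z,
        forall i x, U x -> derivable rho x (unit_rV i) /\
          {for x, continuous (fun y => 'D_(unit_rV i) rho y)},
        exists i, 'D_(unit_rV i) rho z != 0 &
        Omega `&` U = [set x | rho x < 0] `&` U].

End domains.

Section heat_semigroup.
Context (R : realType) (N : nat).
Implicit Types (Omega : set 'rV[R]_N) (x y z : 'rV[R]_N) (s t : R).

Definition laplacian (f : 'rV[R]_N -> R) x : R :=
  \sum_(i < N) 'D_(unit_rV R i) (fun y => 'D_(unit_rV R i) f y) x.

(* Bounded classical solutions of
     u_t = Delta u in (0, oo) x Omega,  u = 0 on [0, oo) x boundary Omega,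
     u(0) = f in Omega.
   Pointwise derivatives suffice for the maximum principle, hence uniqueness. *)
Definition dirichlet_heat_solution Omega (f : 'rV[R]_N -> R)
    (u : R -> 'rV[R]_N -> R) :=
  [/\ {within [set p : R * 'rV[R]_N | 0 <= p.1 /\ closure Omega p.2],
        continuous (fun p => u p.1 p.2)},
      exists M : R, forall t x, 0 <= t -> Omega x -> `|u t x| <= M,
      forall t x, 0 < t -> Omega x ->
        [/\ derivable (u ^~ x) t 1,
            forall i, derivable (u t) x (unit_rV R i) /\
              derivable (fun y => 'D_(unit_rV R i) (u t) y) x (unit_rV R i) &
            'D_1 (u ^~ x) t = laplacian (u t) x],
      forall t x, 0 <= t -> boundary Omega x -> u t x = 0 &
      forall x, Omega x -> u 0 x = f x].

Definition Cc Omega (f : 'rV[R]_N -> R) :=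
  continuous f /\
  exists A, [/\ compact A, A `<=` Omega & forall x, ~ A x -> f x = 0].

Implicit Type K : R -> 'rV[R]_N -> 'rV[R]_N -> R.

(* The operator with kernel [K t] on functions on [Omega]. *)
Definition heat_op Omega K t (f : 'rV[R]_N -> \bar R) x : \bar R :=
  (\int[lebesgue_rV R N]_(y in Omega) ((K t x y)%:E * f y))%E.

(* [K] is the kernel of the Dirichlet heat semigroup e^{t Delta} of [Omega]:
   e^{t Delta} solves the Dirichlet heat equation for initial data in
   C_c(Omega), and the kernel extends it to nonnegative measurable functions.
   The clause on C_c(Omega) determines K(t, x, .) almost everywhere. *)
Definition dirichlet_heat_kernel Omega K :=
  [/\ measurable_fun
        ([set t | 0 < t] `*` (Omega `*` Omega) :
          set (measurableTypeR R * ('rV[R]_N * 'rV[R]_N)))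
        (fun p => K p.1 p.2.1 p.2.2),
      forall t x y, 0 < t -> Omega x -> Omega y -> 0 <= K t x y,
      forall s t x y, 0 < s -> 0 < t -> Omega x -> Omega y ->
        ((K (s + t) x y)%:E = heat_op Omega K s (fun z => (K t z y)%:E) x)%E &
      forall f, Cc Omega f -> exists u, dirichlet_heat_solution Omega f u /\
        forall t x, 0 < t -> Omega x ->
          ((u t x)%:E = heat_op Omega K t (EFin \o f) x)%E].

Definition Linf_norm Omega (f : 'rV[R]_N -> R) : \bar R :=
  'N[lebesgue_rV R N]_+oo%E[(EFin \o f) \_ Omega].

Definition duhamel Omega K (f : R -> 'rV[R]_N -> \bar R) t x : \bar R :=
  (\int[@lebesgue_measure R]_(s in `]0%R, t[) heat_op Omega K (t - s) (f s) x)%E.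

(* [u] is a nonnegative, a.e. finite measurable solution on (0, T) x Omega of
   u(t) = e^{t Delta} u0 + int_0^t e^{(t-s) Delta} (|u(s)|^alpha u(s)) ds,
   the equation being understood a.e. in (0, T) x Omega. *)
Definition integral_solution Omega K (alpha : R) (u0 : 'rV[R]_N -> R) (T : R)
    (u : R -> 'rV[R]_N -> \bar R) :=
  let mu := (@lebesgue_measure R \x lebesgue_rV R N)%E in
  let Q : set (measurableTypeR R * 'rV[R]_N) := `]0, T[ `*` Omega in
  [/\ measurable_fun Q (fun p => u p.1 p.2 : \bar R),
      forall p, Q p -> (0 <= u p.1 p.2)%E,
      \forall p \ae mu, Q p -> u p.1 p.2 \is a fin_num &
      \forall p \ae mu, Q p ->
        (u p.1 p.2 = heat_op Omega K p.1 (EFin \o u0) p.2 +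
          duhamel Omega K (fun s y => `|u s y| `^ alpha * u s y) p.1 p.2)%E].

Definition Tmax Omega K (alpha : R) (u0 : 'rV[R]_N -> R) : \bar R :=
  maxe 0%E (ereal_sup [set T%:E | T in [set T : R |
    0 < T /\ exists u, integral_solution Omega K alpha u0 T u]]).

End heat_semigroup.

(* Main.v *)
Require Import Defs.
From HB Require Import structures.
From mathcomp Require Import all_boot all_order all_algebra.
From mathcomp Require Import all_classical all_reals all_analysis.
From mathcomp Require Import measurable_realfun ess_sup_inf ring lra.
Set Implicit Arguments.
Unset Strict Implicit.
Unset Printing Implicit Defensive.
Import Order.TTheory GRing.Theory Num.Theory.
Import numFieldNormedType.Exports.
Local Open Scope classical_set_scope.
Local Open Scope ring_scope.

(** Let S(t) = e^{t Delta}.  If u solves the integral equation on (0, T), then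
    for almost every (t, x) the function
      W(s) = S(t) u0 (x) + int_0^s S(t - r) [u(r)^(1 + alpha)] (x) dr
    equals S(t - s) u(s) (x) for almost every s < t, so Jensen's inequality for
    the sub-Markovian S(t - s) gives W' >= W^(1 + alpha).  Finiteness of
    W(t) = u(t, x) then forces alpha t (S(t) u0 (x))^alpha <= 1 (Weissler).

    It remains to see that S(t) phi exceeds any level below the essential
    supremum of phi on a set of positive measure for all small t.  As phi >= m
    on a bounded set E of positive measure, it suffices that the integral of
    S(t) 1_E over E tends to |E|.  The maximum principle, with Gaussians as
    supersolutions, bounds the integral of K(t, x, y) in x uniformly in t and y;
    S(t) g -> g for g in C_c(Omega), and the uniform bound transports this
    convergence from C_c to open sets and, by the pi-lambda theorem, to E. *)

(** * Blow-up of the differential inequality *)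

(** Symmetry is not among the clauses describing [K], so the sub-Markov bound controls the integral
    of K(t, x, y) in y only. Yet the passage from C_c(Omega) to 1_E pairs S(t) with 1_E on the other
    side and needs control of the integral in x; the Gaussians stand in for symmetry, with a
    constant depending on N alone.

    Solutions are merely measurable and the equation holds almost everywhere, so the argument keeps
    to increments of W instead of derivatives. Values of phi at points have no meaning either: S(t)
    phi only has to be large on a set of positive measure, at one time t beyond the predicted
    blow-up time. That time tends to 0 as lambda grows, which is why small times suffice.

    Two losses occur, one from the level of phi on E lying below the norm of phi, one from the level
    below 1 that S(t) 1_E is shown to exceed. Both are factors as close to 1 as desired. *)

Section blow_up.
Context {R : realType}.
Implicit Types (alpha a M t h w : R).

(* One implicit step for W' >= W^(1 + alpha): it follows from
   (1 + z)^alpha >= 1 + alpha z / (1 + z), and its error vanishes as h -> 0, so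
   summing it over n equal steps gives the sharp blow-up time. *)
Lemma powR_step alpha h w w' (P : R) : 0 < alpha -> 0 < w -> 0 <= h ->
  w `^ alpha <= P -> w + h * w `^ (1 + alpha) <= w' ->
  alpha * h / (1 + (1 + alpha) * (h * P)) <= (w `^ alpha)^-1 - (w' `^ alpha)^-1.
Proof.
move=> a0 w0 h0 wP ww'.
have p0 : 0 < w `^ alpha by rewrite powR_gt0.
set p := w `^ alpha in p0 wP *; pose z := h * p.
have z0 : 0 <= z by rewrite mulr_ge0// ltW.
have ww : w * (1 + z) <= w'.
  have wE : w `^ (1 + alpha) = w * p.
    by rewrite powRD ?powRr1 ?(ltW w0)//; rewrite (gt_eqF w0) implybT.
  by move: ww'; rewrite wE mulrDr mulr1 mulrCA.
have z1 : 0 < 1 + z by lra.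
have w'0 : 0 < w' by apply: lt_le_trans ww; rewrite mulr_gt0.
have pp : p * (1 + alpha * (z / (1 + z))) <= w' `^ alpha.
  apply: (@le_trans _ _ ((w * (1 + z)) `^ alpha)); last first.
    by apply: ge0_ler_powR => //; rewrite ?nnegrE ?mulr_ge0 ?ltW.
  rewrite powRM ?(ltW w0) ?(ltW z1)// ler_wpM2l ?(ltW p0)//.
  rewrite /powR gt_eqF//.
  apply: le_trans (expR_ge1Dx _); rewrite lerD2l ler_wpM2l ?(ltW a0)//.
  have : ln (1 + - (z / (1 + z))) <= - (z / (1 + z)).
    apply: le_ln1Dx; rewrite ltrN2 ltr_pdivrMr//; lra.
  rewrite (_ : 1 + _ = (1 + z)^-1); last by field; lra.
  by rewrite lnV ?posrE// lerN2.
have : (w' `^ alpha)^-1 <= (p * (1 + alpha * (z / (1 + z))))^-1.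
  rewrite lef_pV2 ?posrE ?powR_gt0// mulr_gt0// ltr_pwDl// mulr_ge0 ?(ltW a0)//.
  by rewrite divr_ge0// ltW.
move=> /(lerB (lexx p^-1)); apply: le_trans.
have az : 0 < 1 + (1 + alpha) * z by rewrite ltr_pwDl// mulr_ge0// addr_ge0// ltW.
rewrite [leRHS](_ : _ = alpha * h / (1 + (1 + alpha) * z)); last first.
  by rewrite /z; field; rewrite -/z; lra.
rewrite ler_wpM2l ?mulr_ge0 ?(ltW a0)// lef_pV2 ?posrE//.
  by rewrite lerD2l !ler_wpM2l//; lra.
rewrite ltr_pwDl// mulr_ge0 ?mulr_ge0//; first by rewrite addr_ge0// ltW.
exact: le_trans (ltW p0) wP.
Qed.

(** The differential inequality enters through increments, with [W] frozen at the left end of the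
    interval, so neither continuity nor differentiability of [W] is required. Over n + 1 equal steps
    W^(-alpha) loses almost alpha * h each time while staying nonnegative; the finite value [M]
    appears only in the error term, which vanishes as n grows. *)
Lemma blow_up_time alpha a M t (W : R -> R) : 0 < alpha -> 0 < a -> 0 < t ->
  a <= W 0 -> W t <= M ->
  (forall s s', 0 <= s -> s <= s' -> s' <= t ->
     W s + (s' - s) * W s `^ (1 + alpha) <= W s') ->
  alpha * t * a `^ alpha <= 1.
Proof.
move=> al0 a0 t0 aW WM HW.
have Wmono s s' : 0 <= s -> s <= s' -> s' <= t -> W s <= W s'.
  move=> s0 ss' s't; apply: le_trans (HW _ _ s0 ss' s't).
  by rewrite lerDl mulr_ge0 ?subr_ge0 ?powR_ge0.
pose P := M `^ alpha.
have aP : 0 < a `^ alpha by rewrite powR_gt0.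
have key n : alpha * t * a `^ alpha <= 1 + (1 + alpha) * t * P / n.+1%:R.
  pose h := t / n.+1%:R; pose d := alpha * h / (1 + (1 + alpha) * (h * P)).
  have h0 : 0 < h by rewrite divr_gt0.
  have hn : h * n.+1%:R = t by rewrite /h divfK// pnatr_eq0.
  have step k : (k <= n.+1)%N ->
      a <= W (h * k%:R) /\ (W (h * k%:R) `^ alpha)^-1 <= (a `^ alpha)^-1 - k%:R * d.
    elim: k => [_|k IH kn].
      rewrite mulr0 mul0r subr0; split => //.
      have W0 : 0 < W 0 by exact: lt_le_trans aW.
      rewrite lef_pV2 ?posrE ?powR_gt0//.
      by apply: ge0_ler_powR => //; rewrite ?nnegrE ltW.
    have [aWk Wk] := IH (ltnW kn).
    have k1 : 0 <= h * k%:R by rewrite mulr_ge0// ltW.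
    have k2 : h * k%:R <= h * k.+1%:R by rewrite ler_pM2l// ler_nat.
    have k3 : h * k.+1%:R <= t by rewrite -hn ler_pM2l// ler_nat.
    have st := HW _ _ k1 k2 k3; split; first by exact: le_trans (Wmono _ _ k1 k2 k3).
    have Wk0 : 0 < W (h * k%:R) by exact: lt_le_trans aWk.
    have al1 : 0 <= 1 + alpha by lra.
    have : d <= (W (h * k%:R) `^ alpha)^-1 - (W (h * k.+1%:R) `^ alpha)^-1.
      apply: powR_step (ltW h0) _ _ => //.
    - have WkM : W (h * k%:R) <= M.
        by apply: le_trans WM; apply: Wmono => //; exact: le_trans k3.
      apply: (ge0_ler_powR (ltW al0) _ _ WkM); rewrite nnegrE ltW//.
      exact: lt_le_trans WkM.
    - apply: le_trans st; rewrite (_ : _ - _ = h)//.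
      by rewrite -mulrBr -natrB// subSnn mulr1.
    rewrite -natr1 mulrDl mul1r; move: Wk.
    set A := (W _ `^ _)^-1; set B := (W _ `^ _)^-1; lra.
  have [_] := step _ (leqnn _); rewrite hn => Wt.
  have dn : n.+1%:R * d = alpha * t / (1 + (1 + alpha) * (h * P)).
    by rewrite /d -hn; ring.
  have P0 : 0 <= P by exact: powR_ge0.
  have q0 : 0 < 1 + (1 + alpha) * (h * P).
    by rewrite ltr_pwDl// !mulr_ge0// ?(ltW h0)//; lra.
  have : n.+1%:R * d <= (a `^ alpha)^-1.
    have : 0 <= (W t `^ alpha)^-1 by rewrite invr_ge0 powR_ge0.
    move: Wt; set A := (W _ `^ _)^-1; lra.
  rewrite dn ler_pdivrMr// [X in _ <= X]mulrC ler_pdivlMr//.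
  by move=> /le_trans; apply; rewrite /h !mulrA mulrAC.
have [//|H1] := lerP (alpha * t * a `^ alpha) 1.
pose e := alpha * t * a `^ alpha - 1.
have e0 : 0 < e by rewrite subr_gt0.
pose C := (1 + alpha) * t * P.
have C0 : 0 <= C by rewrite !mulr_ge0 ?powR_ge0 ?(ltW t0)//; lra.
have [n Cn] : exists n : nat, C / e < n%:R.
  by exists (Num.truncn (C / e)).+1; exact: truncnS_gt.
have := key n; rewrite -/C => K; exfalso.
have : C / n.+1%:R < e.
  rewrite ltr_pdivrMr// mulrC -ltr_pdivrMr//.
  by apply: lt_le_trans Cn _; rewrite ler_nat.
by rewrite /e ltrBrDl => /(le_lt_trans K); rewrite ltxx.
Qed.

End blow_up.

(** * Nonnegative sub-Markovian kernels *)

Section ae_sections.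
Context {d1 d2} {T1 : measurableType d1} {T2 : measurableType d2} {R : realType}.
Variables (m1 : {sigma_finite_measure set T1 -> \bar R})
  (m2 : {sigma_finite_measure set T2 -> \bar R}).
Local Open Scope ereal_scope.

Lemma ae_xsection (P : set (T1 * T2)) : (\forall p \ae (m1 \x m2), P p) ->
  \forall x \ae m1, \forall y \ae m2, P (x, y).
Proof.
move=> [N [mN N0 PN]].
have mS : measurable_fun setT (m2 \o xsection N) by exact: measurable_fun_xsection.
have : \int[m1]_x `|(m2 \o xsection N) x| = 0.
  by rewrite -[RHS]N0; apply: eq_integral => x _ /=; rewrite gee0_abs.
move=> /(ae_eq_integral_abs _ measurableT mS); apply: filterS => x /(_ I) /= Nx.
exists (xsection N x); split => //; first exact: measurable_xsection.
by move=> y Py; rewrite /xsection/= inE; exact: PN.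
Qed.

(** The product measure of the complement is the integral of the measures of its sections, and these
    vanish almost everywhere; measurability of [A] gives access to this formula. *)
Lemma xsection_ae (A : set (T1 * T2)) : measurable A ->
  (\forall x \ae m1, \forall y \ae m2, A (x, y)) -> \forall p \ae (m1 \x m2), A p.
Proof.
move=> mA H; have mC : measurable (~` A) by exact: measurableC.
apply/negligibleP; first exact: mC.
have mS : measurable_fun setT (m2 \o xsection (~` A)) by exact: measurable_fun_xsection.
rewrite /product_measure1; transitivity (\int[m1]_x `|(m2 \o xsection (~` A)) x|).
  by apply: eq_integral => x _ /=; rewrite gee0_abs.
apply/(ae_eq_integral_abs _ measurableT mS); apply: filterS H => x Hx _ /=.
apply/negligibleP; first exact: measurable_xsection.
apply: negligibleS Hx => y /=; rewrite /xsection/= inE; exact.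
Qed.

End ae_sections.

(** The graph of z^(1 + alpha) lies above its tangent at b; this is Young's inequality with the
    conjugate exponents 1 + alpha and (1 + alpha) / alpha. *)
Lemma young_powR {R : realType} (alpha b z : R) : (0 < alpha) -> (0 <= b) -> (0 <= z) ->
  ((1 + alpha) * b `^ alpha * z <= z `^ alpha * z + alpha * b `^ (1 + alpha)).
Proof.
move=> a0 b0 z0.
have a1 : (0 < 1 + alpha) by rewrite addr_gt0.
have := @conjugate_powR R z (b `^ alpha) (1 + alpha) ((1 + alpha) / alpha) z0
  (powR_ge0 _ _) a1 (divr_gt0 a1 a0).
have -> : ((1 + alpha)^-1 + ((1 + alpha) / alpha)^-1 = 1).
  by field; rewrite !gt_eqF.
move=> /(_ erefl).
rewrite -powRrM (_ : alpha * ((1 + alpha) / alpha) = 1 + alpha); last first.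
  by field; rewrite gt_eqF.
have -> : (z `^ (1 + alpha) = z `^ alpha * z).
  by rewrite addrC powRD ?powRr1//; rewrite addrC gt_eqF.
have -> : (z `^ alpha * z / (1 + alpha) + b `^ (1 + alpha) / ((1 + alpha) / alpha) =
  (z `^ alpha * z + alpha * b `^ (1 + alpha)) / (1 + alpha)).
  by field; rewrite !gt_eqF.
rewrite ler_pdivlMr// => H; apply: le_trans H; rewrite (_ : _ * _ = z * b `^ alpha * (1 + alpha))//; ring.
Qed.

(** * Integral operators of a sub-Markovian kernel: semigroup law, Jensen, Duhamel *)

Section sub_markov_kernel.
Context {R : realType} {d} {X : measurableType d}.
Variable mu : {sigma_finite_measure set X -> \bar R}.
Local Notation leb := (@lebesgue_measure R).
Variable k : R -> X -> X -> \bar R.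
Local Open Scope ereal_scope.
Implicit Types (s t : R) (x y z : X) (f g : X -> \bar R).

Definition kop t (f : X -> \bar R) x := \int[mu]_y (k t x y * f y).

Hypothesis mk : measurable_fun setT
  (fun p : measurableTypeR R * (X * X) => k p.1 p.2.1 p.2.2).
Hypothesis k_ge0 : forall (t : R) (x y : X), 0 <= k t x y.
Hypothesis k_le1 : forall (t : R) (x : X), \int[mu]_y k t x y <= 1.
Hypothesis kD : forall (s t : R) (x z : X), (0 < s)%R -> (0 < t)%R ->
  k (s + t) x z = \int[mu]_y (k s x y * k t y z).

Lemma measurable_k {d'} {T : measurableType d'} (h : T -> measurableTypeR R)
    (a b : T -> X) : measurable_fun setT h -> measurable_fun setT a ->
  measurable_fun setT b -> measurable_fun setT (fun q => k (h q) (a q) (b q)).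
Proof.
move=> mh ma mb.
have mq : measurable_fun setT (fun q => (h q, (a q, b q))).
  by apply/measurable_fun_pairP; split => //; apply/measurable_fun_pairP; split.
exact: measurableT_comp mk mq.
Qed.

Lemma measurable_kop {d'} {T : measurableType d'} (h : T -> measurableTypeR R)
    (a : T -> X) (F : T * X -> \bar R) : measurable_fun setT h ->
  measurable_fun setT a -> measurable_fun setT F -> (forall p, 0 <= F p) ->
  measurable_fun setT (fun q => kop (h q) (fun z => F (q, z)) (a q)).
Proof.
move=> mh ma mF F0.
apply: (measurable_fun_fubini_tonelli_F
  (fun p : T * X => k (h p.1) (a p.1) p.2 * F p)) => //.
  by apply: emeasurable_funM => //; apply: measurable_k => //;
    apply: measurableT_comp.
by move=> p; rewrite mule_ge0.
Qed.

Lemma kop_ge0 t f x : (forall y, 0 <= f y) -> 0 <= kop t f x.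
Proof. by move=> f0; apply: integral_ge0 => y _; rewrite mule_ge0. Qed.

Lemma measurable_kx t x : measurable_fun setT (k t x).
Proof. by apply: measurable_k => //; exact: measurable_cst. Qed.

Lemma measurable_kM t x f : measurable_fun setT f ->
  measurable_fun setT (fun y => k t x y * f y).
Proof. by move=> mf; apply: emeasurable_funM => //; exact: measurable_kx. Qed.

Lemma kopD t f g x : measurable_fun setT f -> measurable_fun setT g ->
  (forall y, 0 <= f y) -> (forall y, 0 <= g y) ->
  kop t (fun y => f y + g y) x = kop t f x + kop t g x.
Proof.
move=> mf mg f0 g0; rewrite /kop -ge0_integralD//.
- by apply: eq_integral => y _; rewrite ge0_muleDr.
- by move=> y _; rewrite mule_ge0.
- exact: measurable_kM.
- by move=> y _; rewrite mule_ge0.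
- exact: measurable_kM.
Qed.

Lemma kop_kop s t f x : (0 < s)%R -> (0 < t)%R -> measurable_fun setT f ->
  (forall y, 0 <= f y) -> kop s (kop t f) x = kop (s + t) f x.
Proof.
move=> s0 t0 mf f0; rewrite /kop.
under eq_integral.
  move=> y _; rewrite -ge0_integralZl//; [|exact: measurable_kM|].
  over.
  by move=> z _; rewrite mule_ge0.
have fub := fubini_tonelli (m1 := mu) (m2 := mu)
  (fun p : X * X => k s x p.1 * (k t p.1 p.2 * f p.2)).
rewrite /= in fub; rewrite fub; clear fub.
- apply: eq_integral => z _; rewrite (kD _ _ s0 t0).
  under eq_integral do rewrite muleA.
  have mkk : measurable_fun setT (fun y => k s x y * k t y z).
    apply: emeasurable_funM; first exact: measurable_kx.
    by apply: measurable_k => //; exact: measurable_cst.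
  rewrite ge0_integralZr//.
  by move=> y _; rewrite mule_ge0.
- apply: emeasurable_funM.
    by apply: measurable_k => //; exact: measurable_cst.
  apply: emeasurable_funM; last exact: measurableT_comp.
  by apply: measurable_k => //; exact: measurable_cst.
- by move=> p; rewrite !mule_ge0.
Qed.

(** The tangent inequality of [young_powR] at b = S(t) f (x) is integrated against the kernel. Total
    mass at most 1 is enough, because the constant alpha * b^(1 + alpha) is nonnegative and stands
    on the larger side. *)
Lemma kop_jensen (alpha b : R) t f x : (0 < alpha)%R -> (0 <= b)%R ->
  measurable_fun setT f -> (forall y, 0 <= f y) -> kop t f x = b%:E ->
  (b `^ (1 + alpha))%:E <= kop t (fun y => `|f y| `^ alpha * f y) x.
Proof.
move=> a0 b0 mf f0 fb.
have mg : measurable_fun setT (fun y => `|f y| `^ alpha * f y).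
  apply: emeasurable_funM => //.
  by apply: (measurableT_comp (measurable_poweR _)); exact: measurableT_comp.
have g0 y : 0 <= `|f y| `^ alpha * f y by rewrite mule_ge0// poweR_ge0.
set c := (alpha * b `^ (1 + alpha))%R; have c0 : (0 <= c)%R.
  by rewrite mulr_ge0 ?powR_ge0// ltW.
have a1 : (0 < 1 + alpha)%R by rewrite addr_gt0.
have pt y : ((1 + alpha) * b `^ alpha)%:E * f y <= `|f y| `^ alpha * f y + c%:E.
  have := f0 y; case: (f y) => [z||//]; last first.
    by move=> _; rewrite /= gt_eqF// mulyy addye// leey.
  rewrite lee_fin => z0; rewrite /= (ger0_norm z0) -!EFinM -EFinD lee_fin.
  exact: young_powR.
have : kop t (fun y => ((1 + alpha) * b `^ alpha)%:E * f y) x <=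
    kop t (fun y => `|f y| `^ alpha * f y + c%:E) x.
  apply: ge0_le_integral => //.
  - by move=> y _; rewrite !mule_ge0// lee_fin mulr_ge0 ?powR_ge0// ltW.
  - by apply: measurable_kM; exact: measurable_funeM.
  - by apply: measurable_kM; apply: emeasurable_funD.
  - by move=> y _; rewrite lee_wpmul2l.
rewrite kopD//.
have -> : kop t (fun y => ((1 + alpha) * b `^ alpha)%:E * f y) x =
    ((1 + alpha) * b `^ (1 + alpha))%:E.
  rewrite /kop; under eq_integral do rewrite muleCA.
  rewrite ge0_integralZl//; last 3 first.
  - exact: measurable_kM.
  - by move=> y _; rewrite mule_ge0.
  - by rewrite lee_fin mulr_ge0 ?powR_ge0// ltW.
  rewrite -/(kop t f x) fb -EFinM -mulrA; congr (_ * _)%:E.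
  by rewrite addrC powRD ?powRr1//; rewrite addrC gt_eqF.
have ck : kop t (fun=> c%:E) x <= c%:E.
  rewrite /kop ge0_integralZr//; [|exact: measurable_kx].
  by rewrite -[leRHS]mul1e lee_wpmul2r.
move=> /le_trans => /(_ _ (leeD2l _ ck)).
rewrite mulrDl mul1r EFinD leeD2rE//.
Qed.

Lemma measurable_kop_sub s (g : R -> X -> \bar R) :
  measurable_fun setT (fun q : measurableTypeR R * X => g q.1 q.2) ->
  (forall r y, 0 <= g r y) ->
  measurable_fun setT (fun q : measurableTypeR R * X => kop (s - q.1) (g q.1) q.2).
Proof.
move=> mg g0.
apply: (measurable_kop (h := fun q : measurableTypeR R * X => (s - q.1)%R : measurableTypeR R) (a := snd)
  (F := fun p : measurableTypeR R * X * X => g p.1.1 p.2)) => //.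
  exact: measurable_funB.
have mq : measurable_fun setT (fun p : measurableTypeR R * X * X => (p.1.1, p.2)).
  by apply/measurable_fun_pairP; split;
    [exact: (measurableT_comp measurable_fst measurable_fst)|exact: measurable_snd].
exact: (measurableT_comp mg mq).
Qed.

Lemma measurable_duhamel s (g : R -> X -> \bar R) :
  measurable_fun setT (fun q : measurableTypeR R * X => g q.1 q.2) ->
  (forall r y, 0 <= g r y) ->
  measurable_fun setT (fun y => \int[leb]_(r in `]0%R, s[) kop (s - r) (g r) y).
Proof.
move=> mg g0; pose D : set (measurableTypeR R * X) := fst @^-1` `]0%R, s[.
have mD : measurable D.
  by rewrite -[D]setTI; apply: measurable_fst => //; exact: measurable_itv.
pose G := (fun q : measurableTypeR R * X => kop (s - q.1) (g q.1) q.2) \_ D.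
have mG : measurable_fun setT G.
  by apply/(measurable_restrictT _ mD); apply: measurable_funTS; exact: measurable_kop_sub.
have G0 q : 0 <= G q by apply: erestrict_ge0 => // q' _; exact: kop_ge0.
rewrite (_ : (fun y => _) = fun y => \int[leb]_r G (r, y)).
  exact: measurable_fun_fubini_tonelli_G.
apply/funext => y; rewrite integral_mkcond; apply: eq_integral => r _.
by rewrite /G !patchE.
Qed.

(** By Tonelli and the semigroup law, S(t - s) carries the right-hand side of the integral equation
    at time s to the same expression with t in the kernels and the integral still stopped at s. For
    a solution this is the identity W(s) = S(t - s) u(s). *)
Lemma kop_duhamel s t f (g : R -> X -> \bar R) x : (0 < s < t)%R ->
  measurable_fun setT f -> (forall y, 0 <= f y) ->
  measurable_fun setT (fun q : measurableTypeR R * X => g q.1 q.2) ->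
  (forall r y, 0 <= g r y) ->
  kop (t - s) (fun y => kop s f y + \int[leb]_(r in `]0%R, s[) kop (s - r) (g r) y) x
  = kop t f x + \int[leb]_(r in `]0%R, s[) kop (t - r) (g r) x.
Proof.
move=> /andP[s0 st] mf f0 mg g0.
have ts : (0 < t - s)%R by rewrite subr_gt0.
pose D : set (measurableTypeR R * X) := fst @^-1` `]0%R, s[.
have mD : measurable D.
  by rewrite -[D]setTI; apply: measurable_fst => //; exact: measurable_itv.
pose G := (fun q : measurableTypeR R * X => kop (s - q.1) (g q.1) q.2) \_ D.
have mG : measurable_fun setT G.
  by apply/(measurable_restrictT _ mD); apply: measurable_funTS; exact: measurable_kop_sub.
have G0 q : 0 <= G q by apply: erestrict_ge0 => // q' _; exact: kop_ge0.
have GE y : \int[leb]_(r in `]0%R, s[) kop (s - r) (g r) y = \int[leb]_r G (r, y).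
  rewrite integral_mkcond; apply: eq_integral => r _.
  by rewrite /G !patchE.
have mI : measurable_fun setT (fun y => \int[leb]_r G (r, y)).
  exact: measurable_fun_fubini_tonelli_G.
under [X in kop _ X _]eq_fun do rewrite GE.
rewrite kopD//; last 3 first.
- apply: (measurable_kop (h := fun=> s) (a := id) (F := f \o snd)) => //.
    exact: measurableT_comp.
  by move=> p; exact: f0.
- by move=> y; exact: kop_ge0.
- by move=> y; exact: integral_ge0.
rewrite kop_kop// subrK; congr (_ + _).
rewrite [in RHS]integral_mkcond.
transitivity (\int[mu]_y \int[leb]_r (k (t - s) x y * G (r, y))).
  apply: eq_integral => y _; rewrite ge0_integralZl//.
  exact: (measurableT_comp mG (measurable_pair2 y)).
have mkG : measurable_fun setT (fun q : measurableTypeR R * X => k (t - s) x q.2 * G q).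
  apply: emeasurable_funM => //.
  by apply: measurable_k => //; exact: measurable_cst.
have kG0 (q : measurableTypeR R * X) : 0 <= k (t - s) x q.2 * G q.
  by rewrite mule_ge0.
rewrite -(fubini_tonelli (m1 := leb) (m2 := mu) _ mkG kG0).
apply: eq_integral => r _ /=; rewrite patchE.
case: ifPn => rs.
  rewrite -/(kop (t - r) (g r) x) (_ : t - r = (t - s) + (s - r))%R; last by rewrite addrA subrK.
  have rs' : (0 < s - r)%R.
    by move: rs; rewrite inE /= in_itv/= => /andP[_]; rewrite subr_gt0.
  rewrite -kop_kop//; last exact: (measurableT_comp mg (measurable_pair1 r)).
  by apply: eq_integral => y _; rewrite /G patchE ifT// inE; move: rs; rewrite inE.
have Gz y : G (r, y) = 0.
  by rewrite /G patchE ifF//; apply/negP; rewrite inE; move: rs; rewrite notin_setE.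
under eq_integral do rewrite Gz mule0.
exact: integral0.
Qed.

End sub_markov_kernel.

(** * Weissler's necessary condition for existence *)

Section weissler.
Context {R : realType} {d} {X : measurableType d}.
Variable mu : {sigma_finite_measure set X -> \bar R}.
Local Notation leb := (@lebesgue_measure R).
Variable k : R -> X -> X -> \bar R.
Local Open Scope ereal_scope.
Hypothesis mk : measurable_fun setT
  (fun p : measurableTypeR R * (X * X) => k p.1 p.2.1 p.2.2).
Hypothesis k_ge0 : forall (t : R) (x y : X), 0 <= k t x y.
Hypothesis k_le1 : forall (t : R) (x : X), \int[mu]_y k t x y <= 1.
Hypothesis kD : forall (s t : R) (x z : X), (0 < s)%R -> (0 < t)%R ->
  k (s + t) x z = \int[mu]_y (k s x y * k t y z).
Local Notation kop := (kop mu k).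

Lemma ae_eq_kop t x (f g : X -> \bar R) : measurable_fun setT f ->
  measurable_fun setT g -> (forall y, 0 <= f y) -> (forall y, 0 <= g y) ->
  (\forall y \ae mu, f y = g y) -> kop t f x = kop t g x.
Proof.
move=> mf mg f0 g0 fg; apply: ge0_ae_eq_integral => //.
- exact: measurable_kM.
- exact: measurable_kM.
- by move=> y _; rewrite mule_ge0.
- by move=> y _; rewrite mule_ge0.
- by apply: filterS fg => y -> _.
Qed.

Lemma weissler_bound (alpha T : R) (u0 : X -> \bar R) (u : R -> X -> \bar R) :
  let g s y := `|u s y| `^ alpha * u s y in
  (0 < alpha)%R -> measurable_fun setT u0 -> (forall y, 0 <= u0 y) ->
  measurable_fun setT (fun q : measurableTypeR R * X => u q.1 q.2) ->
  (forall r y, 0 <= u r y) ->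
  (\forall p \ae (leb \x mu), (0 < p.1 < T)%R -> u p.1 p.2 \is a fin_num) ->
  (\forall p \ae (leb \x mu), (0 < p.1 < T)%R -> u p.1 p.2 =
     kop p.1 u0 p.2 + \int[leb]_(s in `]0%R, p.1[) kop (p.1 - s) (g s) p.2) ->
  \forall p \ae (leb \x mu), (0 < p.1 < T)%R ->
    kop p.1 u0 p.2 \is a fin_num /\
    (alpha * p.1 * fine (kop p.1 u0 p.2) `^ alpha <= 1)%R.
Proof.
move=> g al0 mu0 u00 m_u u_ge0 ufin ueq.
have mg : measurable_fun setT (fun q : measurableTypeR R * X => g q.1 q.2).
  apply: emeasurable_funM => //.
  by apply: (measurableT_comp (measurable_poweR _)); exact: measurableT_comp.
have g0 r y : 0 <= g r y by rewrite mule_ge0// poweR_ge0.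
have mus s : measurable_fun setT (u s).
  exact: (measurableT_comp m_u (measurable_pair1 s)).
(* For almost every s the equation at time s holds for almost every y, and this is all that the
   operator S(t - s) sees, whatever the point x. *)
have := ae_xsection ueq => sec.
have FF := ae_filter_ringOfSetsType (leb \x mu).
apply: (@filterS2 _ _ FF) ufin ueq => -[t x] /= fin_tx eq_tx /[dup] /[dup] tT /fin_tx {}fin_tx.
move=> /eq_tx {}eq_tx; have /andP[t0 _] := tT.
pose F r := kop (t - r) (g r) x.
have F0 r : 0 <= F r by exact: kop_ge0.
have mF (D : set R) : measurable D -> measurable_fun D (F : measurableTypeR R -> _).
  move=> mD; apply: measurable_funTS.
  apply: (measurable_kop mu mk k_ge0 (h := fun r : measurableTypeR R => (t - r)%R : measurableTypeR R)
    (a := fun=> x) (F := fun q : measurableTypeR R * X => g q.1 q.2)) => //.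
  exact: measurable_funB.
set a := kop t u0 x; have a0 : 0 <= a by exact: kop_ge0.
pose I s := \int[leb]_(r in `]0%R, s[) F r.
have I0 s : 0 <= I s by exact: integral_ge0.
have Imono s s' : (s <= s')%R -> I s <= I s'.
  move=> ss'; apply: ge0_subset_integral => //; first exact: mF.
  exact: subset_itvl.
have aIt : a + I t \is a fin_num by rewrite -eq_tx.
have afin : a \is a fin_num.
  by rewrite ge0_fin_numE//; apply: le_lt_trans (leeDl _ (I0 t)) _; rewrite -ge0_fin_numE// adde_ge0.
have Ifin s : (s <= t)%R -> I s \is a fin_num.
  move=> st; rewrite ge0_fin_numE//; apply: (le_lt_trans (Imono _ _ st)).
  apply: (@le_lt_trans _ _ (a + I t)); first by rewrite leeDr.
  by rewrite -ge0_fin_numE// adde_ge0.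
(* [blow_up_time] needs a positive initial value; for a = 0 the claim is 0 <= 1, as 0^alpha = 0. *)
split => //; have [->|aN0] := eqVneq a 0.
  by rewrite powR0 ?gt_eqF// mulr0.
pose W s := fine (a + I s).
have WE s : (s <= t)%R -> (W s)%:E = a + I s.
  by move=> st; rewrite fineK// fin_numD afin Ifin.
have W0 s : (0 <= W s)%R by rewrite fine_ge0// adde_ge0.
apply: (@blow_up_time _ alpha (fine a) (W t) t W) => //.
- by rewrite fine_gt0// lt0e aN0 a0 /= ltey_eq afin.
- by rewrite /W /I set_itvoo0 integral_set0 adde0.
have Wjensen : \forall s \ae leb, (0 < s < t)%R -> (W s `^ (1 + alpha))%:E <= F s.
  apply: filterS sec => s sec /andP[s0 st].
  apply: kop_jensen => //; rewrite WE ?ltW//.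
  have mf : measurable_fun setT (fun y => kop s u0 y + \int[leb]_(r in `]0%R, s[) kop (s - r) (g r) y).
    apply: emeasurable_funD; last exact: measurable_duhamel.
    apply: (measurable_kop mu mk k_ge0 (h := fun=> s) (a := id) (F := u0 \o snd)) => //.
      exact: measurableT_comp.
    by move=> p; exact: u00.
  transitivity (kop (t - s) (fun y => kop s u0 y + \int[leb]_(r in `]0%R, s[) kop (s - r) (g r) y) x).
    apply: ae_eq_kop => //.
      by move=> y; rewrite adde_ge0 ?kop_ge0//; apply: integral_ge0 => r _; exact: kop_ge0.
    by apply: filterS sec => y; apply; rewrite s0 (lt_trans st)//; case/andP: tT.
  by rewrite kop_duhamel// s0.
(* The increment of W is at least the integral of F over ]s, s'[, where almost everywhere F(r) >=
   W(r)^(1 + alpha) >= W(s)^(1 + alpha), since W is nondecreasing. *)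
move=> s s' s0; rewrite le_eqVlt => /predU1P[->|ss'] s't.
  by rewrite subrr mul0r addr0.
rewrite -lee_fin EFinD (WE _ s't) WE ?(le_trans (ltW ss'))// -addeA.
rewrite leeD2lE//.
apply: (@le_trans _ _ (I s + \int[leb]_(r in `]s, s'[) F r)).
  rewrite leeD2lE ?Ifin ?(le_trans (ltW ss'))//.
  have mss : measurable (`]s, s'[ : set R) by exact: measurable_itv.
  apply: (@le_trans _ _ (\int[leb]_(r in `]s, s'[) (W s `^ (1 + alpha))%:E)).
    rewrite integral_cst// muleC EFinM lee_wpmul2r ?lee_fin ?powR_ge0//.
    by rewrite [leRHS]lebesgue_measure_itv/= lte_fin ss' EFinB.
  apply: ae_ge0_le_integral => //.
  - by move=> r _; rewrite lee_fin powR_ge0.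
  - exact: mF.
  apply: (@filterS _ _ (ae_filter_ringOfSetsType _)) Wjensen => r H; rewrite /= in_itv/= => /andP[sr rs'].
  have rt : (r < t)%R by exact: lt_le_trans s't.
  apply: le_trans (H _); last by rewrite (le_lt_trans s0 sr).
  rewrite lee_fin; apply: ge0_ler_powR => //; rewrite ?nnegrE//.
    by rewrite addr_ge0// ltW.
  by rewrite -lee_fin !WE ?(ltW rt) ?leeD2l ?Imono ?(ltW sr)// ltW// (lt_trans sr).
rewrite -ge0_integral_setU//.
- apply: ge0_subset_integral => //; first exact: measurableU.
    exact: mF.
  move=> r [|]; rewrite /= !in_itv/= => /andP[r1 r2].
    by rewrite r1 (lt_trans r2).
  by rewrite r2 (le_lt_trans s0).
- by apply: mF; exact: measurableU.
- rewrite disj_set2E; apply/eqP/seteqP; split => // r [].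
  by rewrite /= !in_itv/= => /andP[_ +] /andP[+ _] => /lt_trans /[apply]; rewrite ltxx.
Qed.

End weissler.

(** * The maximum principle *)

Section extrema.
Context {R : realType}.

Lemma is_derive_quotient (g : R -> R) (x d : R) : is_derive x 1 g d ->
  (fun h => h^-1 * (g (h + x) - g x)) @ 0^' --> d.
Proof.
move=> gd; have := @ex_derive _ _ _ _ _ _ _ gd; rewrite /derivable => cg.
move/cvg_ex : (cg) => [l gl]; have dl : d = l.
  by rewrite -(@derive_val _ _ _ _ _ _ _ gd) /derive; apply: (cvg_lim _ gl).
rewrite dl; apply: cvg_trans gl.
rewrite (_ : (fun h => _) = (fun h => h^-1 *: ((g \o shift x) (h *: 1) - g x)))//.
by apply/funext => h /=; rewrite [_%:A]mulr1.
Qed.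

(** Only earlier times are compared, since a maximum over [0, t0] may sit at t0; the left difference
    quotients then give a sign. *)
Lemma derive_left_max (g : R -> R) (t d : R) : 0 < t -> is_derive t 1 g d ->
  (forall s, 0 <= s -> s <= t -> g s <= g t) -> 0 <= d.
Proof.
move=> t0 /is_derive_quotient gd gmax; rewrite leNgt; apply/negP => d0.
have [e /= e0 He] := cvgr_lt _ gd _ d0.
pose h := - (Num.min e t / 2).
have m0 : 0 < Num.min e t by rewrite lt_min e0.
have [me mt] : Num.min e t <= e /\ Num.min e t <= t.
  by split; rewrite ge_min lexx ?orbT.
have h0 : h < 0 by rewrite oppr_lt0 divr_gt0.
have : h^-1 * (g (h + t) - g t) < 0.
  apply: He; last by rewrite lt_eqF.
  by rewrite /= sub0r normrN ltr0_norm//; rewrite /h; lra.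
rewrite nmulr_rlt0 ?invr_lt0// subr_gt0 ltNge => /negP; apply.
by apply: gmax; rewrite /h; lra.
Qed.

(** Continuity of the second derivative is not at hand. If c > 0, then g'(0) = 0 forces g' > 0 just
    to the right of 0, and the mean value theorem makes g exceed its maximum. *)
Lemma second_derive_max (g g' : R -> R) (c d : R) : 0 < d ->
  (forall r : R, `|r| < d -> is_derive r 1 g (g' r)) -> is_derive (0 : R) 1 g' c ->
  (forall r : R, `|r| < d -> g r <= g 0) -> c <= 0.
Proof.
move=> d0 gg' g'c gmax; rewrite leNgt; apply/negP => c0.
have itvE r : r \in `]-d, d[ -> `|r| < d by rewrite in_itv/= ltr_norml.
have g'0 : g' 0 = 0.
  have := @derive1_at_max _ g (- d) d 0.
  rewrite in_itv/= oppr_lt0 d0/= ge0_cp// ?ltW// => H.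
  have {}H : is_derive (0 : R) 1 g 0.
    apply: H => // t td; [exact: (@ex_derive _ _ _ _ _ _ _ (gg' t (itvE _ td)))|].
    exact: gmax (itvE _ td).
  have gg'0 : is_derive (0 : R) 1 g (g' 0) by apply: gg'; rewrite normr0.
  by have := @derive_val _ _ _ _ _ _ _ H; rewrite (@derive_val _ _ _ _ _ _ _ gg'0).
have [e /= e0 He] := cvgr_gt _ (is_derive_quotient g'c) _ c0.
pose b := Num.min e d / 2.
have m0 : 0 < Num.min e d by rewrite lt_min e0.
have [me md] : Num.min e d <= e /\ Num.min e d <= d.
  by split; rewrite ge_min lexx ?orbT.
have b0 : 0 < b by rewrite divr_gt0.
have bd x : 0 <= x -> x <= b -> `|x| < d.
  by move=> x0 xb; rewrite ger0_norm//; move: xb; rewrite /b; lra.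
have [x|x xb|x] := @MVT R g g' 0 b b0.
- by rewrite in_itv/= => /andP[/ltW x0 /ltW xb]; apply: gg'; exact: bd.
- apply: derivable_within_continuous => y; rewrite in_itv/= => /andP[y0 yb].
  exact: (@ex_derive _ _ _ _ _ _ _ (gg' y (bd _ y0 yb))).
rewrite in_itv/= => /andP[x0 xb]; rewrite subr0 => gb.
have : 0 < x^-1 * (g' (x + 0) - g' 0).
  apply: He; last by rewrite gt_eqF.
  by rewrite /= sub0r normrN gtr0_norm//; move: xb; rewrite /b; lra.
rewrite g'0 subr0 addr0 pmulr_rgt0 ?invr_gt0// => g'x.
have := gmax b (bd _ (ltW b0) (lexx _)).
by rewrite -subr_le0 gb leNgt mulr_gt0.
Qed.

End extrema.

Section lines.
Context {R : realType} {V : normedModType R}.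

Lemma is_derive_line (f : V -> R) (x e : V) (r d : R) :
  is_derive (r *: e + x) e f d -> is_derive r 1 (fun s => f (s *: e + x)) d.
Proof.
move=> fd; have E : (fun h => h^-1 *: ((f \o shift (r *: e + x)) (h *: e) - f (r *: e + x))) =
  (fun h : R => h^-1 *: (((fun s => f (s *: e + x)) \o shift r) (h *: 1) - f (r *: e + x))).
  by apply/funext => h /=; rewrite [_%:A]mulr1 scalerDl addrA.
split; last by rewrite -(@derive_val _ _ _ _ _ _ _ fd) /derive E.
by have := @ex_derive _ _ _ _ _ _ _ fd; rewrite /derivable E.
Qed.

Lemma derive2_max (Omega : set V) (f df : V -> R) (x e : V) (c : R) :
  open Omega -> Omega x -> (forall y, Omega y -> is_derive y e f (df y)) ->
  is_derive x e df c -> (forall y, Omega y -> f y <= f x) -> c <= 0.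
Proof.
move=> oO Ox fdf dfc fmax.
have : \forall r \near (0 : R), Omega (r *: e + x).
  have : (fun r : R => r *: e + x) @ (0 : R) --> (0 : R) *: e + x.
    by apply: cvgD; [exact: scalel_continuous|exact: cvg_cst].
  rewrite scale0r add0r => /(_ Omega); apply; exact: open_nbhs_nbhs.
move=> [d /= d0 dO].
have dO' r : `|r| < d -> Omega (r *: e + x).
  by move=> rd; apply: dO; rewrite /= sub0r normrN.
apply: (@second_derive_max _ (fun r => f (r *: e + x)) (fun r => df (r *: e + x)) c d) => //.
- by move=> r rd; apply: is_derive_line; apply: fdf; exact: dO'.
- by apply: is_derive_line; rewrite scale0r add0r.
- by move=> r rd; rewrite scale0r add0r; apply: fmax; exact: dO'.
Qed.

End lines.

(** * Comparison of heat solutions with supersolutions *)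

Section comparison.
Context {R : realType} {N : nat}.
Implicit Types (Omega : set 'rV[R]_N) (x y : 'rV[R]_N) (t : R).
Local Notation e_ i := (@unit_rV R N i).

Lemma is_derive_affine (V : normedModType R) (f : V -> R) (x v : V) (c : R) :
  (forall h, f (h *: v + x) = f x + h * c) -> is_derive x v f c.
Proof.
move=> fE; have H : (fun h => h^-1 *: ((f \o shift x) (h *: v) - f x)) @ 0^' --> c.
  apply: cvg_near_cst; near=> h; rewrite /= fE addrAC subrr add0r.
  by rewrite [_ *: _]mulKf//; near: h; exact: nbhs_dnbhs_neq.
split; first by apply/cvg_ex; exists c.
exact: (cvg_lim _ H).
Unshelve. all: by end_near. Qed.

Lemma is_derive_coord (i j : 'I_N) x : is_derive x (e_ i) (fun y => y ord0 j) (i == j)%:R.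
Proof.
by apply: is_derive_affine => h; rewrite !mxE eqxx/= addrC eq_sym.
Qed.

(** The squared Euclidean norm: the norm of ['rV[R]_N] is the maximum norm, which is not
    differentiable. *)
Definition sqn x := \sum_j x ord0 j ^+ 2.

Lemma is_derive_sqn (i : 'I_N) x : is_derive x (e_ i) sqn (2 * x ord0 i).
Proof.
have H : is_derive x (e_ i) (\sum_(j < N) (fun y => y ord0 j ^+ 2))
    (\sum_(j < N) (2 * x ord0 j * (i == j)%:R)).
  apply: is_derive_sum => j.
  have := @is_deriveX _ _ (fun y => y ord0 j) 2 x (e_ i) _ (is_derive_coord i j x).
  by rewrite expr1; exact.
rewrite (_ : sqn = \sum_(j < N) (fun y => y ord0 j ^+ 2)); last first.
  by apply/funext => y; rewrite fct_sumE.
rewrite (_ : 2 * _ = \sum_(j < N) (2 * x ord0 j * (i == j)%:R))//.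
rewrite (bigD1 i)//= eqxx mulr1 big1 ?addr0// => j ji.
by rewrite eq_sym (negbTE ji) mulr0.
Qed.

Lemma continuous_sqn : continuous sqn.
Proof.
move=> x; rewrite (_ : sqn = \sum_(j < N) (fun y => y ord0 j ^+ 2)); last first.
  by apply/funext => y; rewrite fct_sumE.
move: x; apply: (big_ind (fun f : 'rV[R]_N -> R => continuous f)).
- exact: (@cst_continuous _ _ (0 : R)).
- by move=> f g cf cg x; apply: (@continuousD _ _ _ f g x); [exact: cf|exact: cg].
move=> j _ x; rewrite (_ : (fun y => _) = (fun y : 'rV[R]_N => y ord0 j * y ord0 j)); last first.
  by apply/funext => y; rewrite expr2.
by apply: (@continuousM _ _ (fun y : 'rV[R]_N => y ord0 j) (fun y => y ord0 j) x); exact: coord_continuous.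
Qed.

Lemma sqn_ge0 x : 0 <= sqn x.
Proof. by apply: sumr_ge0 => j _; rewrite sqr_ge0. Qed.

Lemma compact_sqn_le (A : set 'rV[R]_N) (B : R) : closed A ->
  compact (A `&` [set x | sqn x <= B]).
Proof.
move=> cA; apply: bounded_closed_compact; last first.
  apply: closedI => //; rewrite [X in closed X](_ : _ = sqn @^-1` [set r | r <= B])//.
  by apply: closed_comp; [move=> x _; exact: continuous_sqn|exact: closed_le].
(* Each coordinate satisfies x_j^2 <= B < (B + 1)^2, so B + 1 bounds it without a square root. *)
exists (B + 1); split; first exact: num_real.
move=> M BM x [_ /= xB]; apply: le_trans (ltW BM).
have B0 : 0 <= B by exact: le_trans (sqn_ge0 x) xB.
rewrite /Num.norm/= mx_normrE; apply: bigmax_le; first by rewrite addr_ge0.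
move=> [i j] _ /=; rewrite (ord1 i).
have : x ord0 j ^+ 2 <= B.
  apply: le_trans xB; rewrite /sqn (bigD1 j)//= lerDl.
  by apply: sumr_ge0 => k _; rewrite sqr_ge0.
rewrite -[_ ^+ 2]real_normK ?num_real// => H.
rewrite leNgt; apply/negP => H1; have : (B + 1) ^+ 2 < `|x ord0 j| ^+ 2.
  by rewrite ltr_pXn2r// nnegrE// addr_ge0.
move=> /lt_le_trans/(_ H); rewrite sqrrD1; move/lt_geF/negP; apply.
have := sqr_ge0 B; nra.
Qed.

(** If u > w somewhere, a penalised difference [v] has a positive maximum on a compact set. It is
    not on the boundary, where u = 0 <= w, nor at time 0, where u = f <= w. At an interior point the
    first derivative in time and the second derivatives in space have signs that contradict the
    strict inequality satisfied by w plus the penalty. *)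
Lemma heat_comparison Omega f (u w wt : R -> 'rV[R]_N -> R)
    (wi wii : 'I_N -> R -> 'rV[R]_N -> R) :
  open Omega -> dirichlet_heat_solution Omega f u ->
  (forall t x, 0 <= t -> 0 <= w t x) ->
  (forall t x, 0 <= t ->
     {for (t, x), continuous (fun p : R * 'rV[R]_N => w p.1 p.2)}) ->
  (forall t x, 0 < t -> is_derive t 1 (w ^~ x) (wt t x)) ->
  (forall i t x, 0 < t -> is_derive x (e_ i) (w t) (wi i t x)) ->
  (forall i t x, 0 < t -> is_derive x (e_ i) (wi i t) (wii i t x)) ->
  (forall t x, 0 < t -> \sum_i wii i t x <= wt t x) ->
  (forall x, Omega x -> f x <= w 0 x) ->
  forall t x, 0 <= t -> Omega x -> u t x <= w t x.
Proof.
move=> oO [cu [M uM] pde ubd u0] w0 cw wT wX wXX wheat fw t0 x0 t00 Ox0.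
rewrite leNgt; apply/negP => uw.
(* The Laplacian of |x|^2 is 2 N, so with this slope in time the heat operator applied to the
   penalty gives e * (c - 2 N) = e > 0. *)
pose c : R := 2 * N%:R + 1; have c0 : 0 < c.
  by rewrite /c ltr_wpDl// mulr_ge0.
have p0 : 0 < 1 + c * t0 + sqn x0.
  by rewrite ltr_pwDl// ?sqn_ge0// ltr_pwDl// mulr_ge0// ltW.
(* The penalty at (t0, x0) is half of the gap u - w there, so [v] stays positive at that point. *)
pose e := (u t0 x0 - w t0 x0) / (2 * (1 + c * t0 + sqn x0)).
have e0 : 0 < e by rewrite divr_gt0 ?subr_gt0// mulr_gt0.
(* The penalty [e * (1 + c * t + |x|^2)] confines the maximum of [v] to a
   compact set and makes [w + penalty] a strict supersolution. *)
pose v t x := u t x - w t x - e * (1 + c * t + sqn x).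
have v0 : 0 < v t0 x0.
  rewrite /v (_ : e * _ = (u t0 x0 - w t0 x0) / 2).
    by move: uw; rewrite -subr_gt0; lra.
  by rewrite /e; field; rewrite gt_eqF.
have v_far t x : 0 <= t -> Omega x -> M / e < sqn x -> v t x < 0.
  move=> t_ge0 Ox; rewrite ltr_pdivrMr// => Mq.
  have := uM _ _ t_ge0 Ox; have := w0 _ x t_ge0; have := ler_norm (u t x).
  have : 0 <= e * (1 + c * t) by rewrite mulr_ge0 ?(ltW e0)// addr_ge0// mulr_ge0// ltW.
  by rewrite /v mulrDr; nra.
pose A : set (R * 'rV[R]_N) :=
  `[0, t0]%classic `*` (closure Omega `&` [set x | sqn x <= M / e]).
have cA : compact A.
  apply: compact_setX; first exact: segment_compact.
  by apply: compact_sqn_le; exact: closed_closure.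
have Ap : A (t0, x0).
  split; first by rewrite /= in_itv/= t00 lexx.
  split; first exact: subset_closure.
  by rewrite /= leNgt; apply/negP => /(v_far _ _ t00 Ox0)/(lt_trans v0); rewrite ltxx.
have cv : {within A, continuous (fun p => v p.1 p.2)}.
  have cA1 : {within A, continuous (fun p => u p.1 p.2)}.
    apply: continuous_subspaceW cu => -[t x] [/= + [Ox _]]; rewrite in_itv/=.
    by case/andP.
  have cA2 : {within A, continuous (fun p : R * 'rV[R]_N => w p.1 p.2)}.
    apply: continuous_in_subspaceT => -[t x]; rewrite inE => -[/= + _].
    by rewrite in_itv/= => /andP[t1 _]; exact: cw.
  have cA3 : {within A, continuous (fun p : R * 'rV[R]_N => e * (1 + c * p.1 + sqn p.2))}.
    apply: continuous_subspaceT => p; apply: cvgM; first exact: cvg_cst.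
    apply: cvgD; last by apply: (cvg_comp _ _ cvg_snd); exact: continuous_sqn.
    apply: cvgD; first exact: cvg_cst.
    by apply: cvgM; [exact: cvg_cst|exact: cvg_fst].
  move=> p; apply: cvgB; last exact: cA3.
  by apply: cvgB; [exact: cA1|exact: cA2].
have [[t1 x1]] := compact_EVT_max (ex_intro _ _ Ap) cA cv.
rewrite inE => -[/= t1t0 [clx1 qx1]] vmax.
move: t1t0; rewrite in_itv/= => /andP[t1_ge0 t1t0].
have v1 : 0 < v t1 x1.
  by apply: lt_le_trans v0 _; apply: (vmax (t0, x0)); rewrite inE.
have pen1 : 0 < e * (1 + c * t1 + sqn x1).
  by rewrite mulr_gt0// ltr_pwDl// ?sqn_ge0// ltr_pwDl// mulr_ge0// ltW.
have Ox1 : Omega x1.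
  apply: contrapT => nO; have := ubd _ x1 t1_ge0 (conj clx1 nO) => u10.
  by have := w0 _ x1 t1_ge0; move: v1; rewrite /v u10; lra.
have t1_gt0 : 0 < t1.
  rewrite lt_neqAle t1_ge0 andbT; apply/eqP => t10.
  by move: v1 pen1 (fw _ Ox1); rewrite /v -t10 u0//; lra.
have [du dxu ut] := pde _ _ t1_gt0 Ox1.
have dvt : is_derive t1 1 (v ^~ x1) ('D_1 (u ^~ x1) t1 - wt t1 x1 - e * c).
  have h1 := @is_deriveB _ _ _ _ _ _ _ _ _ (derivableP du) (wT t1 x1 t1_gt0).
  have h2 : is_derive t1 1 (fun t => e * (1 + c * t + sqn x1)) (e * c).
    by apply: is_derive_affine => h; rewrite [h *: 1]mulr1; ring.
  exact: (@is_deriveB _ _ _ _ _ _ _ _ _ h1 h2).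
have D0 : 0 <= 'D_1 (u ^~ x1) t1 - wt t1 x1 - e * c.
  apply: derive_left_max dvt _ => // s s0 st1.
  apply: (vmax (s, x1)); rewrite inE; split => //=.
  by rewrite in_itv/= s0 (le_trans st1).
have D2 i : 'D_(e_ i) (fun y => 'D_(e_ i) (u t1) y) x1 - wii i t1 x1 - e * 2 <= 0.
  apply: (@derive2_max _ _ Omega (v t1)
    (fun y => 'D_(e_ i) (u t1) y - wi i t1 y - e * (2 * y ord0 i)) x1 (e_ i)) => //.
  - move=> y Oy; have [_ /(_ i)[dy _] _] := pde _ _ t1_gt0 Oy.
    have h1 := @is_deriveB _ _ _ _ _ _ _ _ _ (derivableP dy) (wX i t1 y t1_gt0).
    have h2 : is_derive y (e_ i) (fun y => e * (1 + c * t1 + sqn y)) (e * (2 * y ord0 i)).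
      have h3 := @is_deriveD _ _ _ _ _ _ _ _ _ (is_derive_cst (1 + c * t1) y (e_ i)) (is_derive_sqn i y).
      have h4 := @is_deriveZ _ _ _ _ e _ _ _ h3.
      by rewrite add0r in h4; exact: h4.
    exact: (@is_deriveB _ _ _ _ _ _ _ _ _ h1 h2).
  - have [_ d2] := dxu i.
    have h1 := @is_deriveB _ _ _ _ _ _ _ _ _ (derivableP d2) (wXX i t1 x1 t1_gt0).
    have h2 : is_derive x1 (e_ i) (fun y => e * (2 * y ord0 i)) (e * 2).
      apply: is_derive_affine => h; rewrite !mxE eqxx/= eqxx mulr1n; ring.
    exact: (@is_deriveB _ _ _ _ _ _ _ _ _ h1 h2).
  - move=> y Oy; have [far|near] := ltP (M / e) (sqn y).
      by apply: le_trans (ltW v1); apply: ltW; exact: v_far.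
    apply: (vmax (t1, y)); rewrite inE; split => /=; first by rewrite in_itv/= t1_ge0.
    by split => //; exact: subset_closure.
have : \sum_i ('D_(e_ i) (fun y => 'D_(e_ i) (u t1) y) x1 - wii i t1 x1 - e * 2) <= 0.
  by apply: sumr_le0 => i _; exact: D2.
rewrite !sumrB -/(laplacian (u t1) x1) -ut sumr_const card_ord -mulr_natr.
have := wheat _ x1 t1_gt0; move: D0; rewrite /c; nra.
Qed.

End comparison.

(** * Continuous functions with compact support and Borel sets *)

Section exhaustion.
Context {R : realType} {N : nat}.
Implicit Types (O : set 'rV[R]_N) (x y : 'rV[R]_N).

(** [d] is the distance to the complement. That distance is infinite when the complement is empty,
    whence the constant 1 in this case. *)
Lemma open_gap O : open O -> exists d : 'rV[R]_N -> R,
  [/\ continuous d, forall y, 0 <= d y, forall y, O y -> 0 < d y &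
      forall y, ~ O y -> d y = 0].
Proof.
move=> oO; have [OT|/set0P[a /= nOa]] := eqVneq (~` O) set0.
  exists (fun=> 1); split => //.
    exact: cst_continuous.
  move=> y nOy; have : (~` O) y by [].
  by rewrite OT.
have dfin y : edist_inf (~` O) y \is a fin_num.
  have dya : (edist_inf (~` O) y <= edist (y, a))%E.
    by apply: ereal_inf_lbound; exists a.
  rewrite ge0_fin_numE ?edist_inf_ge0//; apply: (le_lt_trans dya).
  rewrite -ge0_fin_numE ?edist_ge0//; apply/edist_finP; exists (`|y - a| + 1).
    by rewrite ltr_wpDl.
  by rewrite -ball_normE/= ltrDl.
exists (fun y => fine (edist_inf (~` O) y)); split.
- move=> y; have H : edist_inf (~` O) z @[z --> y] --> (fine (edist_inf (~` O) y))%:E.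
    by rewrite fineK//; exact: edist_inf_continuous.
  exact: (fine_cvg H).
- by move=> y; rewrite fine_ge0// edist_inf_ge0.
- move=> y Oy; rewrite fine_gt0// -ge0_fin_numE ?edist_inf_ge0// dfin andbT lt_neqAle edist_inf_ge0 andbT.
  apply/eqP => d0; have /nbhs_ballP[e /= e0 eO] : nbhs y O by exact: open_nbhs_nbhs.
  have : (edist_inf (~` O) y < e%:E)%E by rewrite -d0 lte_fin.
  move=> /ereal_inf_lt[_ [b nOb <-]] /(@edist_lt_ball _ _ e (y, b)) /= yb.
  by apply: nOb; exact: eO.
- by move=> y nOy; rewrite edist_inf0.
Qed.

Definition clip01 (r : R) := Num.min 1 (Num.max 0 r).

Lemma clip01_itv r : 0 <= clip01 r <= 1.
Proof. by rewrite /clip01 ge_min lexx le_min ler01 le_max lexx. Qed.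

Lemma continuous_clip01 : continuous clip01.
Proof.
move=> r; apply: continuous_min; first exact: cvg_cst.
by apply: continuous_max; [exact: cvg_cst|exact: cvg_id].
Qed.

Lemma clip01_eq0 r : r <= 0 -> clip01 r = 0.
Proof. by move=> r0; rewrite /clip01 max_l// min_r. Qed.

Lemma clip01_eq1 r : 1 <= r -> clip01 r = 1.
Proof. by move=> r1; rewrite /clip01 min_l// le_max r1 orbT. Qed.

Lemma Cc_exhaustion O : open O -> exists g : nat -> 'rV[R]_N -> R,
  [/\ forall k, Cc O (g k), forall k y, 0 <= g k y <= 1,
      forall k y, ~ O y -> g k y = 0 &
      forall y, O y -> exists k0, forall k, (k0 <= k)%N -> g k y = 1].
Proof.
move=> oO; have [d [cd d0 dO dnO]] := open_gap oO.
(* The first factor vanishes where d <= 1 / k and equals 1 where d >= 2 / k; the second vanishes for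
   |y| >= k and equals 1 for |y| <= k - 1, which makes the support bounded. *)
pose g k y := clip01 (k%:R * d y - 1) * clip01 (k%:R - `|y|).
have gnO k y : ~ O y -> g k y = 0.
  by move=> /dnO dy; rewrite /g dy clip01_eq0 ?mul0r// mulr0 sub0r lerN10.
exists g; split=> //.
- move=> k; have cg : continuous (g k).
    have c1 : continuous (clip01 \o (fun y => k%:R * d y - 1)).
      move=> y; apply: continuous_comp; last exact: continuous_clip01.
      apply: (@continuousB _ _ _ (fun y => k%:R * d y) (fun=> 1)); last exact: cst_continuous.
      by apply: (@continuousM _ _ (fun=> k%:R) d); [exact: cst_continuous|exact: cd].
    have c2 : continuous (clip01 \o (fun y : 'rV[R]_N => k%:R - `|y|)).
      move=> y; apply: continuous_comp; last exact: continuous_clip01.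
      have cn : {for y, continuous (fun y : 'rV[R]_N => `|y|)} by exact: norm_continuous.
      have cc : {for y, continuous (fun y : 'rV[R]_N => k%:R : R)} by exact: cst_continuous.
      exact: (continuousB cc cn).
    by move=> y; exact: (@continuousM _ _ _ _ y (c1 y) (c2 y)).
  split => //; exists ([set y | 1 <= k%:R * d y] `&` [set y | `|y| <= k%:R]); split.
  + apply: bounded_closed_compact.
      exists k%:R; split; first exact: num_real.
      by move=> M kM y [_ /= yk]; exact: le_trans (ltW kM).
    apply: closedI.
      rewrite [X in closed X](_ : _ = (fun y => k%:R * d y) @^-1` [set r | 1 <= r])//.
      apply: closed_comp; last exact: closed_ge.
      by move=> y _; apply: (@continuousM _ _ (fun=> k%:R) d); [exact: cst_continuous|exact: cd].
    rewrite [X in closed X](_ : _ = (fun y : 'rV[R]_N => `|y|) @^-1` [set r | r <= k%:R])//.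
    by apply: closed_comp; [move=> y _; exact: norm_continuous|exact: closed_le].
  + move=> y [/= dy _]; apply: contrapT => /dnO dy0; move: dy.
    by rewrite dy0 mulr0 ler10.
  + move=> y /not_andP[] /negP; rewrite -ltNge => H; rewrite /g.
      by rewrite clip01_eq0 ?mul0r// subr_le0 ltW.
    by rewrite (@clip01_eq0 (_ - `|y|)) ?mulr0// subr_le0 ltW.
- move=> k y; rewrite /g; have /andP[a0 a1] := clip01_itv (k%:R * d y - 1).
  have /andP[b0 b1] := clip01_itv (k%:R - `|y|).
  by rewrite mulr_ge0//= mulr_ile1.
- move=> y Oy; exists (Num.truncn (2 / d y + `|y| + 1)).+1 => k k0.
  have dy := dO _ Oy.
  have : 2 / d y + `|y| + 1 < k%:R.
    by apply: lt_le_trans (truncnS_gt _) _; rewrite ler_nat.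
  have : 0 < 2 / d y by rewrite divr_gt0.
  move=> H1 H2; rewrite /g !clip01_eq1 ?mulr1//.
    have := normr_ge0 y; lra.
  rewrite lerBrDr (_ : 1 + 1 = 2 :> R)// -ler_pdivrMr//.
  have := normr_ge0 y; lra.
Qed.

End exhaustion.

(** * Open sets and the coordinate sigma-algebra *)

Section borel_rV.
Context {R : realType} {N : nat}.
Local Notation V := 'rV[R]_N.

(** Rational centres and radii 1 / (n + 1) give a countable base of the topology whose members are
    measurable through the coordinates. *)
Definition rat_cube (p : 'rV[rat]_N * nat) : set V :=
  [set x | forall i, `|x ord0 i - ratr (p.1 ord0 i)| < p.2.+1%:R^-1].

Lemma measurable_rat_cube p : measurable (rat_cube p).
Proof.
rewrite (_ : rat_cube p = \bigcap_(i in [set: 'I_N])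
   (@rV_coord R N i @^-1` ball (ratr (p.1 ord0 i) : R) p.2.+1%:R^-1)); last first.
  apply/seteqP; split => x H i; first by move=> _; rewrite /= /ball/= distrC; exact: H.
  by have := H i I; rewrite /= /ball/= distrC.
apply: fin_bigcap_measurable => // i _; rewrite -[X in measurable X]setTI.
by apply: measurable_rV_coord => //; exact: measurable_ball.
Qed.

Lemma open_rat_cubeP (U : set V) (x : V) : open U -> U x ->
  exists p, rat_cube p x /\ rat_cube p `<=` U.
Proof.
move=> oU Ux; have /nbhs_ballP[e /= e0 eU] : nbhs x U by exact: open_nbhs_nbhs.
pose n := Num.truncn (2 / e).
have ne : 2 * (n.+1%:R^-1) < e.
  by rewrite ltr_pdivrMr// mulrC -ltr_pdivrMr// truncnS_gt.
have n0 : 0 < n.+1%:R^-1 :> R by rewrite invr_gt0.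
have /choice[q qx] : forall i, exists q : rat, `|x ord0 i - ratr q| < n.+1%:R^-1.
  move=> i; have [|q] := @rat_in_itvoo R (x ord0 i) (x ord0 i + n.+1%:R^-1).
    by rewrite ltrDl.
  rewrite in_itv/= => /andP[xq qx]; exists q.
  by rewrite ltr0_norm ?subr_lt0// opprB ltrBlDl.
exists (\row_i q i, n); split => [i|y yq]; first by rewrite mxE.
apply: eU; split => // i j; rewrite (ord1 i) /ball/=.
have := yq j; rewrite /= mxE => H; have := qx j => H'.
rewrite -(subrK (ratr (q j)) (x ord0 j)) -addrA.
apply: le_lt_trans (ler_normD _ _) _; apply: lt_trans ne.
by rewrite mulr_natl mulr2n ltrD// distrC.
Qed.

Lemma open_measurable_rV (U : set V) : open U -> measurable U.
Proof.
move=> oU; pose F k := if unpickle k is Some p then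
  (if `[< rat_cube p `<=` U >] then rat_cube p else set0) else set0.
rewrite (_ : U = \bigcup_k F k).
  apply: bigcup_measurable => k _; rewrite /F; case: (unpickle k) => [p|//].
  by case: ifP => // _; exact: measurable_rat_cube.
apply/seteqP; split => [x Ux|x [k _]].
  have [p [px pU]] := open_rat_cubeP oU Ux.
  by exists (pickle p) => //; rewrite /F pickleK; case: asboolP.
by rewrite /F; case: (unpickle k) => [p|//]; case: asboolP => // pU; exact: pU.
Qed.

(** The pi-lambda theorem for the pi-system of open sets; these generate the coordinate
    sigma-algebra because coordinates are continuous. *)
Lemma rV_lambda_system (D : set (set V)) : lambda_system setT D ->
  (forall U, open U -> D U) -> forall B : set V, measurable B -> D B.
Proof.
move=> lD oD B mB.
have oI : setI_closed (@open V) by move=> A C; exact: openI.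
apply: (@lambda_system_subset _ _ oI setT _ lD) => //.
suff : g_sigma_preimage (@rV_coord R N) `<=` <<s setT, open >> by apply.
apply: smallest_sub; first exact: smallest_sigma_algebra.
move=> A; rewrite -bigcup_seq => -[i _ [C mC <-]]; rewrite setTI.
pose S := [set C : set R | <<s setT, @open V >> (@rV_coord R N i @^-1` C)].
have [s0 sC sU] := @smallest_sigma_algebra _ [set: V] open.
have sS : sigma_algebra setT S.
  split.
  - by rewrite /S/= preimage_set0.
  - by move=> E SE; rewrite /S/= setTD -preimage_setC -setTD; exact: sC.
  - by move=> F SF; rewrite /S/= preimage_bigcup; exact: sU.
suff : (@RGenOpens.G R).-sigma.-measurable `<=` S.
  by apply; rewrite -RGenOpens.measurableE.
apply: smallest_sub => // _ [a [b ->]]; rewrite /S/=.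
apply: (@sub_sigma_algebra _ setT (@open V)).
have cc : {in @rV_coord R N i @^-1` `]a, b[%classic,
    continuous (fun v : V => v ord0 i : R)}.
  by move=> x _; exact: coord_continuous.
by apply: (open_comp cc); exact: interval_open.
Qed.

End borel_rV.

(** * Lebesgue measure on row vectors *)

Section lebesgue_rV_theory.
Context {R : realType}.
Local Notation leb := (@lebesgue_measure R).
Local Notation lebn := (@lebesgue_rV R).

Lemma rV_cons_ord0 n (x : R) (y : 'rV[R]_n) : rV_cons (x, y) ord0 ord0 = x.
Proof. by have := congr1 fst (rV_consK ((x, y) : measurableTypeR R * _)). Qed.

Lemma rV_cons_lift n (x : R) (y : 'rV[R]_n) (i : 'I_n) :
  rV_cons (x, y) ord0 (lift ord0 i) = y ord0 i.
Proof.
rewrite /rV_cons/= (_ : lift ord0 i = rshift 1 i); last exact: val_inj.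
exact: row_mxEr.
Qed.

Local Open Scope ereal_scope.

Lemma integral_rV_cons n (f : 'rV[R]_n.+1 -> \bar R) : measurable_fun setT f ->
  (forall v, 0 <= f v) ->
  \int[lebn n.+1]_v f v = \int[leb]_x \int[lebn n]_y f (rV_cons (x, y)).
Proof.
move=> mf f0.
have mfc := measurableT_comp mf (@measurable_rV_cons R n).
rewrite -(fubini_tonelli1 (m1 := leb) (m2 := lebn n) _ mfc (fun=> f0 _)).
by rewrite -(@ge0_integral_pushforward _ _ _ _ _ _ (@measurable_rV_cons R n) _ setT).
Qed.

Lemma ae_rV_cons n (A : set 'rV[R]_n.+1) : measurable A ->
  (\forall x \ae leb, \forall y \ae lebn n, A (rV_cons (x, y))) ->
  \forall v \ae lebn n.+1, A v.
Proof.
move=> mA H; apply/negligibleP; first exact: measurableC.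
have mB : measurable (@rV_cons R n @^-1` A).
  by rewrite -[X in measurable X]setTI; exact: measurable_rV_cons.
have := @xsection_ae _ _ _ _ _ leb (lebn n) _ mB H.
by move/negligibleP; apply; exact: measurableC.
Qed.

Lemma integral_rV_prod n (g : 'I_n -> R -> R) :
  (forall i, measurable_fun setT (g i)) -> (forall i x, (0 <= g i x)%R) ->
  \int[lebn n]_v (\prod_i g i (v ord0 i))%:E = \prod_i \int[leb]_x (g i x)%:E.
Proof.
have mprod m (h : 'I_m -> R -> R) : (forall i, measurable_fun setT (h i)) ->
    measurable_fun setT (fun v : 'rV[R]_m => (\prod_i h i (v ord0 i))%:E).
  move=> mh; apply/measurable_EFinP; apply: measurable_prod => i _.
  exact: (measurableT_comp (mh i) (@measurable_rV_coord R m i)).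
elim: n g => [|n IH] g mg g0.
  rewrite big_ord0; under eq_integral do rewrite big_ord0.
  by rewrite integral_dirac// diracT mul1e.
rewrite integral_rV_cons//; last by move=> v; rewrite lee_fin prodr_ge0.
  rewrite big_ord_recl -IH//.
  rewrite -ge0_integralZr//; last 3 first.
  - by apply/measurable_EFinP; exact: mg.
  - by move=> x _; rewrite lee_fin.
  - by apply: integral_ge0 => v _; rewrite lee_fin prodr_ge0.
  apply: eq_integral => x _; rewrite -ge0_integralZl//; last 3 first.
  - exact: (mprod _ (fun i => g (lift ord0 i)) (fun i => mg _)).
  - by move=> v _; rewrite lee_fin prodr_ge0.
  - by rewrite lee_fin.
  apply: eq_integral => v _; rewrite -EFinM; congr (_%:E).
  rewrite big_ord_recl rV_cons_ord0; congr (_ * _)%R.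
  by apply: eq_bigr => i _; rewrite rV_cons_lift.
exact: (mprod _ g mg).
Qed.

(** Lebesgue differentiation: at almost every point g is the limit of its averages, all at most c.
    Only rational intervals are tested, so that the induction on the dimension meets countably many
    conditions. *)
Lemma ae_le_density_R (g : R -> \bar R) (c : R) :
  measurable_fun setT (g : measurableTypeR R -> \bar R) ->
  (forall x, 0 <= g x) -> (0 <= c)%R ->
  (forall a b : rat, (a < b)%R -> \int[leb]_(x in `]ratr a, ratr b[) g x
     <= (c * (ratr b - ratr a))%:E) ->
  \forall x \ae leb, g x <= c%:E.
Proof.
move=> mg g0 c0 Hg.
have HgR (a b : R) : (a < b)%R -> \int[leb]_(x in `]a, b[) g x <= (c * (b - a))%:E.
  move=> ab; apply/lee_addgt0Pr => e e0.
  (* Moving each end outwards to a rational within h costs at most 2 * c * h <= e; the 1 added to c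
     covers c = 0. *)
  pose h := (e / (2 * (c + 1)))%R.
  have h0 : (0 < h)%R by rewrite divr_gt0// mulr_gt0// ltr_wpDl.
  have [p] := @rat_in_itvoo R (a - h) a ltac:(by rewrite gtrBl).
  rewrite in_itv/= => /andP[pa ap].
  have [q] := @rat_in_itvoo R b (b + h) ltac:(by rewrite ltrDl).
  rewrite in_itv/= => /andP[bq qb].
  have pq : (p < q)%R by rewrite -(ltr_rat R) (lt_trans ap)// (lt_trans ab).
  apply: (@le_trans _ _ (\int[leb]_(x in `]ratr p, ratr q[) g x)).
    apply: ge0_subset_integral => //; first exact: measurable_funTS.
    by apply: subset_itv; rewrite bnd_simp ltW.
  apply: le_trans (Hg _ _ pq) _; rewrite -EFinD lee_fin.
  have : (ratr q - ratr p <= b - a + 2 * h)%R by lra.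
  move=> /(ler_wpM2l c0)/le_trans; apply; rewrite mulrDr lerD2l.
  rewrite /h (_ : c * (2 * _) = e * (c / (c + 1)))%R; last by field; lra.
  by rewrite ler_piMr ?(ltW e0)// ler_pdivrMr ?mul1r; lra.
have gfin : \forall x \ae leb, g x \is a fin_num.
  have : forall n : nat, \forall x \ae leb, (`](- n%:R)%R, n%:R%R[%classic : set R) x -> g x \is a fin_num.
    move=> n; apply: integrable_ae => //; apply/integrableP; split.
      exact: measurable_funTS.
    under eq_integral do rewrite gee0_abs//.
    case: n => [|n]; first by rewrite oppr0 set_itvoo0 integral_set0.
    by apply: le_lt_trans (HgR _ _ _) _; rewrite ?ltry// gtrN.
  move/ae_foralln; apply: filterS => x Hx.
  apply: (Hx (Num.truncn `|x|).+1); rewrite /= in_itv/= -ltr_norml.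
  exact: truncnS_gt.
pose f x := fine (g x).
have f0 x : (0 <= f x)%R by rewrite fine_ge0.
have mf : measurable_fun setT (f : measurableTypeR R -> R) by exact: measurableT_comp.
have fg x : (f x)%:E <= g x.
  by rewrite /f; have := g0 x; case: (g x) => //= r _; rewrite leey.
have locf : locally_integrable setT f.
  split => //; first exact: openT.
  move=> A _ cA; have [M [_ MA]] := compact_bounded cA.
  have M1A : A `<=` `](- (`|M| + 2))%R, (`|M| + 2)%R[.
    move=> x Ax; rewrite /= in_itv/= -ltr_norml.
    apply: le_lt_trans (MA (`|M| + 1)%R _ x Ax) _; last by rewrite ltrD2l ltr1n.
    by rewrite ltr_pwDr// ler_norm.
  apply: (@le_lt_trans _ _ (\int[leb]_(x in `](- (`|M| + 2))%R, (`|M| + 2)%R[) g x)).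
    apply: (@le_trans _ _ (\int[leb]_(x in A) g x)).
      apply: ge0_le_integral => //; first exact: compact_measurable.
      + by apply: measurable_funTS; apply/measurable_EFinP; exact: measurableT_comp.
      + exact: measurable_funTS.
      + by move=> x _; rewrite ger0_norm.
    apply: ge0_subset_integral => //; first exact: compact_measurable.
    exact: measurable_funTS.
  apply: le_lt_trans (HgR _ _ _) _; rewrite ?ltry// gtrN//.
have := lebesgue_differentiation locf.
apply: (@filterS2 _ _ (ae_filter_ringOfSetsType _) _ _ _ _ gfin) => x gx xpt.
rewrite -(fineK gx) -/(f x).
(* The average of f over the ball is at most c, so f(x) - c is at most the mean of |f - f(x)|, which
   tends to 0 at a Lebesgue point. *)
have key (r : R) : (0 < r)%R -> (f x)%:E - c%:E <= davg f x r.
  move=> r0; have mB : measurable (ball x r : set R) by exact: measurable_ball.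
  have lB : leb (ball x r) = (2 * r)%:E by rewrite lebesgue_measure_ball ?ltW// mulr_natl.
  have r20 : (0 < 2 * r)%R by rewrite mulr_gt0.
  rewrite /davg /iavg lB inver gt_eqF//.
  rewrite lee_pdivlMl//.
  have I1 : \int[leb]_(y in ball x r) (f x)%:E = (2 * r * f x)%:E.
    by rewrite integral_cst// [X in _ * X = _]lB -EFinM mulrC.
  have I2 : \int[leb]_(y in ball x r) (f y)%:E <= (2 * r * c)%:E.
    apply: (@le_trans _ _ (\int[leb]_(y in ball x r) g y)).
      apply: ge0_le_integral => //.
      - by move=> y _; rewrite lee_fin.
      - by apply: measurable_funTS; exact/measurable_EFinP.
      - exact: measurable_funTS.
    rewrite ball_itv; apply: le_trans (HgR _ _ _) _; first by lra.
    by rewrite lee_fin; lra.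
  rewrite -EFinB -EFinM mulrBr EFinB -I1 leeBlDr//.
  apply: (@le_trans _ _ (\int[leb]_(y in ball x r)
      (`|((center (f x) \o f) y)%:E| + (f y)%:E))).
    apply: ge0_le_integral => //.
    - by move=> y _; rewrite lee_fin.
    - apply: measurable_funTS; apply: emeasurable_funD.
        apply: measurableT_comp => //; apply/measurable_EFinP.
        exact: measurable_funB.
      exact/measurable_EFinP.
    - move=> y _ /=; rewrite -EFinD lee_fin.
      by have := ler_norm (- (f y - f x))%R; rewrite normrN; lra.
  rewrite ge0_integralD//.
  - exact: leeD2l.
  - apply: measurable_funTS; apply: measurableT_comp => //; apply/measurable_EFinP.
    exact: measurable_funB.
  - by move=> y _; rewrite lee_fin.
  - by apply: measurable_funTS; exact/measurable_EFinP.
rewrite -sube_le0; apply: cvge_to_ge xpt _.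
near=> r; apply: key; near: r; exact: nbhs_right_gt.
Unshelve. all: by end_near. Qed.

End lebesgue_rV_theory.

(** * Density bounds in every dimension *)

Section density_rV.
Context {R : realType}.
Local Notation leb := (@lebesgue_measure R).
Local Notation lebn := (@lebesgue_rV R).

Definition rat_box n (a b : 'rV[rat]_n) : set 'rV[R]_n :=
  [set x | forall i, ratr (a ord0 i) < x ord0 i < ratr (b ord0 i)].

Lemma measurable_rat_box n (a b : 'rV[rat]_n) : measurable (rat_box a b).
Proof.
rewrite (_ : rat_box a b = \bigcap_(i in [set: 'I_n])
   (@rV_coord R n i @^-1` `]ratr (a ord0 i), ratr (b ord0 i)[)); last first.
  by apply/seteqP; split => x H i; have := H i; rewrite /= in_itv/=; [|exact].
apply: fin_bigcap_measurable => // i _; rewrite -[X in measurable X]setTI.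
by apply: measurable_rV_coord => //; exact: measurable_itv.
Qed.

Local Open Scope ereal_scope.

(** Induction on the dimension reduces this to differentiation on the line. For a fixed rational box
    in the last n coordinates, the integral of [k] over the box is a function of the first
    coordinate to which [ae_le_density_R] applies. Rational boxes are countable, so almost every
    slice satisfies all these bounds at once, and the induction hypothesis applies to it. *)
Lemma ae_le_density_rV n (k : 'rV[R]_n -> \bar R) (c : R) :
  measurable_fun setT k -> (forall v, 0 <= k v) -> (0 <= c)%R ->
  (forall a b : 'rV[rat]_n, (forall i, a ord0 i < b ord0 i)%R ->
     \int[lebn n]_(v in rat_box a b) k v
     <= (c * \prod_i (ratr (b ord0 i) - ratr (a ord0 i)))%:E) ->
  \forall v \ae lebn n, k v <= c%:E.
Proof.
elim: n k c => [|n IH] k c mk k0 c0 Hk.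
  have H := Hk 0%R 0%R (fun i => False_ind _ (notF (ltn_ord i))).
  apply: aeW => v; rewrite (_ : v = 0%R); last by apply/rowP => -[].
  move: H; rewrite big_ord0 mulr1 integral_dirac//.
  - by rewrite diracE mem_set ?mul1e//; case.
  - exact: measurable_rat_box.
  - exact: measurable_funTS.
have mkc : measurable_fun setT (fun p : measurableTypeR R * 'rV[R]_n => k (rV_cons p)).
  exact: (measurableT_comp mk (@measurable_rV_cons R n)).
have mkx x : measurable_fun setT (fun y => k (rV_cons (x, y))).
  exact: (measurableT_comp mkc (measurable_pair1 (x : measurableTypeR R))).
pose G (a b : 'rV[rat]_n) (x : R) := \int[lebn n]_(y in rat_box a b) k (rV_cons (x, y)).
have GE a b x : G a b x = \int[lebn n]_y (k (rV_cons (x, y)) * (\1_(rat_box a b) y)%:E).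
  rewrite /G integral_mkcond; apply: eq_integral => y _.
  by rewrite patchE indicE; case: ifP => _; rewrite ?mule1 ?mule0.
have mind a b : measurable_fun setT (fun y : 'rV[R]_n => (\1_(rat_box a b) y : R)%:E).
  by apply/measurable_EFinP; apply: measurable_indic; exact: measurable_rat_box.
have mG a b : measurable_fun setT (G a b : measurableTypeR R -> \bar R).
  rewrite (_ : G a b = fun x => \int[lebn n]_y (k (rV_cons (x, y)) * (\1_(rat_box a b) y)%:E)).
    apply: (measurable_fun_fubini_tonelli_F (m2 := lebn n)
      (fun p : measurableTypeR R * 'rV[R]_n => k (rV_cons p) * (\1_(rat_box a b) p.2)%:E)).
      by apply: emeasurable_funM => //; exact: (measurableT_comp (mind a b) measurable_snd).
    by move=> p; rewrite mule_ge0// lee_fin.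
  by apply/funext => x; exact: GE.
have HG : \forall x \ae leb, forall a b : 'rV[rat]_n, (forall i, a ord0 i < b ord0 i)%R ->
    G a b x <= (c * \prod_i (ratr (b ord0 i) - ratr (a ord0 i)))%:E.
  have : forall m : nat, \forall x \ae leb, forall a b : 'rV[rat]_n,
      unpickle m = Some (a, b) -> (forall i, a ord0 i < b ord0 i)%R ->
      G a b x <= (c * \prod_i (ratr (b ord0 i) - ratr (a ord0 i)))%:E.
    move=> m; case: (unpickle m) => [[a b]|]; last by apply: aeW.
    have [ab|nab] := pselect (forall i, a ord0 i < b ord0 i)%R; last first.
      by apply: aeW => x _ _ [<- <-] /nab.
    suff : \forall x \ae leb,
        G a b x <= (c * \prod_i (ratr (b ord0 i) - ratr (a ord0 i)))%:E.
      by apply: (@filterS _ _ (ae_filter_ringOfSetsType _)) => x Hx _ _ [<- <-].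
    apply: ae_le_density_R => //.
    - by move=> x; apply: integral_ge0.
    - by rewrite mulr_ge0// prodr_ge0// => i _; rewrite subr_ge0 ler_rat ltW.
    move=> p q pq.
    pose a' : 'rV[rat]_n.+1 := row_mx (const_mx p : 'rV[rat]_1) a.
    pose b' : 'rV[rat]_n.+1 := row_mx (const_mx q : 'rV[rat]_1) b.
    have e0 : (ord0 : 'I_n.+1) = lshift n (ord0 : 'I_1) by exact: val_inj.
    have a'0 : a' ord0 ord0 = p.
      by rewrite /a' e0; apply: etrans (row_mxEl _ _ _ _) _; rewrite mxE.
    have b'0 : b' ord0 ord0 = q.
      by rewrite /b' e0; apply: etrans (row_mxEl _ _ _ _) _; rewrite mxE.
    have a'i i : a' ord0 (lift ord0 i) = a ord0 i.
      rewrite (_ : lift ord0 i = rshift 1 i); last exact: val_inj.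
      exact: row_mxEr.
    have b'i i : b' ord0 (lift ord0 i) = b ord0 i.
      rewrite (_ : lift ord0 i = rshift 1 i); last exact: val_inj.
      exact: row_mxEr.
    have ab' i : (a' ord0 i < b' ord0 i)%R.
      by case: (unliftP ord0 i) => [j|] ->; rewrite ?a'i ?b'i ?a'0 ?b'0.
    have := Hk _ _ ab'.
    rewrite big_ord_recl a'0 b'0.
    rewrite (eq_bigr (fun i => ratr (b ord0 i) - ratr (a ord0 i) : R)%R); last first.
      by move=> i _; rewrite a'i b'i.
    rewrite mulrCA [((_ - _) * _)%R]mulrC.
    apply: le_trans; rewrite le_eqVlt; apply/orP; left; apply/eqP.
    rewrite [RHS]integral_mkcond integral_rV_cons; last 2 first.
    - by apply/(measurable_restrictT _ (measurable_rat_box a' b')); exact: measurable_funTS.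
    - by move=> v; apply: erestrict_ge0.
    rewrite integral_mkcond; apply: eq_integral => x _.
    rewrite patchE; case: ifPn => xpq.
      rewrite /G integral_mkcond; apply: eq_integral => y _.
      rewrite !patchE; congr (if _ then _ else _).
      move: xpq; rewrite inE /= in_itv/= => /andP[px xq].
      apply/idP/idP; rewrite !inE => H i.
        case: (unliftP ord0 i) => [j|] ->; last by rewrite a'0 b'0 rV_cons_ord0 px.
        by rewrite a'i b'i rV_cons_lift; exact: H.
      by have := H (lift ord0 i); rewrite a'i b'i rV_cons_lift.
    rewrite (_ : (fun y => _) = cst 0) ?integral0//.
    apply/funext => y; rewrite patchE ifF//; apply/negP; rewrite inE => /(_ ord0).
    by rewrite a'0 b'0 rV_cons_ord0; move: xpq; rewrite notin_setE /= in_itv/=.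
  move=> /ae_foralln; apply: (@filterS _ _ (ae_filter_ringOfSetsType _)) => x Hx a b ab.
  by apply: (Hx (pickle (a, b))) => //; rewrite pickleK.
have mA : measurable [set v : 'rV[R]_n.+1 | k v <= c%:E].
  rewrite (_ : mkset _ = k @^-1` `]-oo, c%:E]); last first.
    by apply/seteqP; split => v; rewrite /= in_itv.
  by rewrite -[X in measurable X]setTI; apply: mk => //; exact: emeasurable_itv.
apply: (ae_rV_cons mA).
apply: (@filterS _ _ (ae_filter_ringOfSetsType _)) HG => x Hx.
exact: (IH (fun y => k (rV_cons (x, y))) c (mkx x) (fun y => k0 _) c0 Hx).
Qed.

End density_rV.

(** * Gaussian supersolutions *)

Section supersolutions.
Context {R : realType} {N : nat}.
Implicit Types (t : R) (x : 'rV[R]_N).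
Local Notation e_ i := (@unit_rV R N i).

(** Supersolutions live on the whole space, so one function serves every Omega; nonnegativity takes
    care of the boundary condition. *)
Definition heat_supersolution (w : R -> 'rV[R]_N -> R) :=
  [/\ forall t x, 0 <= t -> 0 <= w t x,
      forall t x, 0 <= t ->
        {for (t, x), continuous (fun p : R * 'rV[R]_N => w p.1 p.2)} &
      exists wt : R -> 'rV[R]_N -> R, exists wi wii : 'I_N -> R -> 'rV[R]_N -> R,
      [/\ forall t x, 0 < t -> is_derive t 1 (w ^~ x) (wt t x),
          forall i t x, 0 < t -> is_derive x (e_ i) (w t) (wi i t x),
          forall i t x, 0 < t -> is_derive x (e_ i) (wi i t) (wii i t x) &
          forall t x, 0 < t -> \sum_i wii i t x <= wt t x]].

Lemma le_heat_supersolution Omega f u w : open Omega ->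
  dirichlet_heat_solution Omega f u -> heat_supersolution w ->
  (forall x, Omega x -> f x <= w 0 x) ->
  forall t x, 0 <= t -> Omega x -> u t x <= w t x.
Proof.
move=> oO uf [w0 cw [wt [wi [wii [? ? ? ?]]]]] fw.
exact: (@heat_comparison _ _ Omega f u w wt wi wii).
Qed.

Lemma heat_supersolution1 : heat_supersolution (fun _ _ => 1).
Proof.
split=> //; first by move=> t x _; exact: cst_continuous.
exists (fun _ _ => 0), (fun _ _ _ => 0), (fun _ _ _ => 0); split.
- by move=> t x _; exact: is_derive_cst.
- by move=> i t x _; exact: is_derive_cst.
- by move=> i t x _; exact: is_derive_cst.
- by move=> t x _; rewrite big1.
Qed.

Lemma is_derive_of_line (V : normedModType R) (f : V -> R) (x e : V) (d : R) :
  is_derive (0 : R) 1 (fun s => f (s *: e + x)) d -> is_derive x e f d.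
Proof.
move=> fd; have E : (fun h => h^-1 *: ((f \o shift x) (h *: e) - f x)) =
  (fun h : R => h^-1 *: (((fun s => f (s *: e + x)) \o shift 0) (h *: 1) - f (0 *: e + x))).
  by apply/funext => h /=; rewrite addr0 [_%:A]mulr1 scale0r add0r.
split; first by have := @ex_derive _ _ _ _ _ _ _ fd; rewrite /derivable -E.
by rewrite -(@derive_val _ _ _ _ _ _ _ fd) /derive E.
Qed.

Section gaussian.
Variables m d : 'I_N -> R.
Hypothesis d_gt0 : forall i, 0 < d i.

Definition var i t := d i ^+ 2 + t.

(** Logarithm of e^(1/4) * d_i times v^(-1/2) * exp (- (z - m_i)^2 / (4 v)) with v = d_i^2 + t, a
    multiple of the one-dimensional heat kernel at time v; [var] is thus half the variance. The
    factor e^(1/4) * d_i makes the value at t = 0 exactly 1 at the ends |z - m_i| = d_i. *)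
Definition log_gauss i t (z : R) :=
  4^-1 + ln (d i) - 2^-1 * ln (var i t) - (z - m i) ^+ 2 * (4 * var i t)^-1.

Definition gauss t x := expR (\sum_i log_gauss i t (x ord0 i)).

Lemma var_gt0 i t : 0 <= t -> 0 < var i t.
Proof. by move=> t0; rewrite ltr_pwDl// exprn_gt0. Qed.

(** Along a coordinate line the Gaussian is its value at x times the exponential of a polynomial in
    h without constant term, so directional derivatives reduce to a derivative at h = 0. *)
Lemma gauss_line i t x (h : R) : gauss t (h *: e_ i + x) = gauss t x *
  expR (h * (- (x ord0 i - m i) * (2 * var i t)^-1 + h * (- (4 * var i t)^-1))).
Proof.
rewrite /gauss -expRD; congr expR.
rewrite (bigD1 i)//= [in RHS](bigD1 i)//= [RHS]addrAC; congr (_ + _); last first.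
  by apply: eq_bigr => j ji; rewrite !mxE eqxx/= (negbTE ji) mulr0 add0r.
rewrite /log_gauss !mxE !eqxx/= mulr1.
by rewrite !invfM; set v := (var i t)^-1; field.
Qed.

Lemma is_derive_gauss i t x : is_derive x (e_ i) (gauss t)
  (gauss t x * (- (x ord0 i - m i) * (2 * var i t)^-1)).
Proof.
apply: is_derive_of_line.
set q1 := - (x ord0 i - m i) * _; pose q2 := - (4 * var i t)^-1.
have h1 : is_derive (0 : R) 1 (fun h => q1 + h * q2) q2.
  by apply: is_derive_affine => h; rewrite [_ *: _]mulr1; ring.
have h2 := @is_deriveM _ _ _ _ _ _ _ _ (is_derive_id (0 : R) 1) h1.
have h2' : is_derive (0 : R) 1 (fun h => h * (q1 + h * q2)) q1.
  apply: (is_derive_eq h2).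
  by rewrite mul0r addr0 scale0r add0r [_ *: _]mulr1.
have h3 : is_derive (0 : R) 1 (expR \o (fun h => h * (q1 + h * q2))) (1 * q1).
  apply: is_derive1_comp; rewrite mul0r.
    by have := is_derive_expR (0 : R); rewrite expR0.
have h4 := @is_deriveZ _ _ _ _ (gauss t x) _ _ _ h3.
rewrite mul1r in h4.
rewrite (_ : (fun s => _) = (fun h => gauss t x * expR (h * (q1 + h * q2)))); first exact: h4.
by apply/funext => h; rewrite gauss_line.
Qed.

Lemma is_derive_gauss2 i t x : is_derive x (e_ i)
  (fun y => gauss t y * (- (y ord0 i - m i) * (2 * var i t)^-1))
  (gauss t x * ((x ord0 i - m i) ^+ 2 * (2 * var i t)^-1 ^+ 2 - (2 * var i t)^-1)).
Proof.
have h1 : is_derive x (e_ i) (fun y => - (y ord0 i - m i) * (2 * var i t)^-1)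
    (- (2 * var i t)^-1).
  by apply: is_derive_affine => h; rewrite !mxE !eqxx/=; ring.
have h2 := @is_deriveM _ _ _ _ _ _ _ _ (is_derive_gauss i t x) h1.
apply: (is_derive_eq h2); rewrite /GRing.scale/=; ring.
Qed.

Lemma is_derive_gauss_time t x : 0 < t -> is_derive t 1 (gauss ^~ x)
  (\sum_i gauss t x * ((x ord0 i - m i) ^+ 2 * (2 * var i t)^-1 ^+ 2 - (2 * var i t)^-1)).
Proof.
move=> t0.
have h i : is_derive t 1 (fun s => log_gauss i s (x ord0 i))
    ((x ord0 i - m i) ^+ 2 * (2 * var i t)^-1 ^+ 2 - (2 * var i t)^-1).
  have v0 := var_gt0 i (ltW t0).
  have hv : is_derive t 1 (var i) 1.
    by apply: is_derive_affine => h; rewrite /var [_ *: _]mulr1; ring.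
  have hl : is_derive t 1 (@ln R \o var i) ((var i t)^-1 * 1).
    by apply: is_derive1_comp; exact: is_derive1_ln.
  have hi : is_derive t 1 (fun s => (var i s)^-1) (- (var i t) ^- 2 *: 1).
    by apply: is_deriveV; rewrite gt_eqF.
  have h1 := @is_deriveZ _ _ _ _ (2^-1) _ _ _ hl.
  have h2 := @is_deriveZ _ _ _ _ ((x ord0 i - m i) ^+ 2 / 4) _ _ _ hi.
  have h3 := @is_deriveB _ _ _ _ _ _ _ _ _ (is_derive_cst (4^-1 + ln (d i)) t 1) h1.
  have h4 := @is_deriveB _ _ _ _ _ _ _ _ _ h3 h2.
  rewrite (_ : (fun s => _) = cst (4^-1 + ln (d i)) - 2^-1 *: (@ln R \o var i) -
      ((x ord0 i - m i) ^+ 2 / 4) *: (fun s => (var i s)^-1)); last first.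
    by apply/funext => s; rewrite /log_gauss invfM mulrA.
  apply: (is_derive_eq h4); rewrite /GRing.scale/=.
  by field; rewrite gt_eqF.
have hs := is_derive_sum h.
rewrite (_ : \sum_(i < N) _ = fun s => \sum_i log_gauss i s (x ord0 i)) in hs; last first.
  by apply/funext => s; rewrite fct_sumE.
have he : is_derive t 1 (expR \o (fun s => \sum_i log_gauss i s (x ord0 i)))
   (gauss t x * \sum_i ((x ord0 i - m i) ^+ 2 * (2 * var i t)^-1 ^+ 2 - (2 * var i t)^-1)).
  by apply: is_derive1_comp; exact: is_derive_expR.
by rewrite -mulr_sumr.
Qed.

Lemma continuous_gauss t x : 0 <= t ->
  {for (t, x), continuous (fun p : R * 'rV[R]_N => gauss p.1 p.2)}.
Proof.
move=> t0.
have ci i : {for (t, x), continuous (fun p : R * 'rV[R]_N => log_gauss i p.1 (p.2 ord0 i))}.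
  have v0 := var_gt0 i t0.
  have cv : {for (t, x), continuous (fun p : R * 'rV[R]_N => var i p.1)}.
    apply: continuousD; first exact: cst_continuous.
    exact: cvg_fst.
  have cz : {for (t, x), continuous (fun p : R * 'rV[R]_N => p.2 ord0 i - m i)}.
    apply: continuousB; last exact: cst_continuous.
    apply: (@continuous_comp _ _ _ snd (fun y : 'rV[R]_N => y ord0 i)); first exact: cvg_snd.
    exact: coord_continuous.
  have cl : {for (t, x), continuous (@ln R \o (fun p : R * 'rV[R]_N => var i p.1))}.
    by apply: continuous_comp => //; exact: continuous_ln.
  apply: continuousB; first apply: continuousB; first exact: cst_continuous.
    apply: continuousM; first exact: cst_continuous.
    exact: cl.
  apply: continuousM; first exact: (continuousM cz cz).
  apply: continuousV; first by rewrite /= gt_eqF// mulr_gt0.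
  by apply: continuousM; [exact: cst_continuous|exact: cv].
apply: (@continuous_comp _ _ _ (fun p : R * 'rV[R]_N => \sum_i log_gauss i p.1 (p.2 ord0 i)) expR);
  last exact: continuous_expR.
rewrite (_ : (fun p => _) = \sum_i (fun p : R * 'rV[R]_N => log_gauss i p.1 (p.2 ord0 i))); last first.
  by apply/funext => p; rewrite fct_sumE.
apply: (big_ind (fun f : R * 'rV[R]_N -> R => {for (t, x), continuous f})).
- exact: (@cst_continuous _ _ (0 : R)).
- by move=> f g; exact: continuousD.
- by move=> i _; exact: ci.
Qed.

Lemma heat_supersolution_gauss : heat_supersolution gauss.
Proof.
split; first by move=> t x _; exact: expR_ge0.
  by move=> t x; exact: continuous_gauss.
exists (fun t x => \sum_i gauss t x * ((x ord0 i - m i) ^+ 2 * (2 * var i t)^-1 ^+ 2 - (2 * var i t)^-1)).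
exists (fun i t x => gauss t x * (- (x ord0 i - m i) * (2 * var i t)^-1)).
exists (fun i t x => gauss t x * ((x ord0 i - m i) ^+ 2 * (2 * var i t)^-1 ^+ 2 - (2 * var i t)^-1)).
split => //.
- exact: is_derive_gauss_time.
- by move=> i t x _; exact: is_derive_gauss.
- by move=> i t x _; exact: is_derive_gauss2.
Qed.

Lemma gauss0_ge1 x : (forall i, `|x ord0 i - m i| <= d i) -> 1 <= gauss 0 x.
Proof.
move=> H; rewrite /gauss -expR0 ler_expR sumr_ge0// => i _.
rewrite /log_gauss /var addr0 lnXn ?d_gt0// -[ln _ *+ 2]mulr_natl mulKf// addrK.
rewrite subr_ge0 invfM mulrCA ler_piMr// ler_pdivrMr ?exprn_gt0// mul1r.
by rewrite -(ger0_norm (sqr_ge0 (x ord0 i - m i))) normrX lerXn2r// nnegrE ltW.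
Qed.

(** Up to a constant factor this is the normal density of variance 2 v. The mass is independent of t
    and proportional to d_i, which is what makes the later bound uniform in time and in the box. *)
Lemma integral_log_gauss i t : 0 <= t ->
  (\int[@lebesgue_measure R]_z (expR (log_gauss i t z))%:E =
   (expR 4^-1 * Num.sqrt (4 * pi) * d i)%:E)%E.
Proof.
move=> t0; have v0 := var_gt0 i t0; set v := var i t in v0.
pose s := Num.sqrt (2 * v).
have s2 : s ^+ 2 = 2 * v by rewrite sqr_sqrtr// mulr_ge0// ltW.
have s0 : s != 0 by rewrite gt_eqF// sqrtr_gt0 mulr_gt0.
have pi4 : 0 <= 4 * pi :> R by rewrite mulr_ge0// pi_ge0.
have E z : expR (log_gauss i t z) =
    expR 4^-1 * Num.sqrt (4 * pi) * d i * normal_pdf (m i) s z.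
  rewrite normal_pdfE// /normal_peak /normal_fun s2 /log_gauss -/v.
  rewrite !expRD lnK ?posrE//.
  have -> : expR (- (2^-1 * ln v)) = (Num.sqrt v)^-1.
    by rewrite expRN -powR12_sqrt ?(ltW v0)// /powR gt_eqF.
  have -> : 2 * v * pi *+ 2 = v * (4 * pi) :> R by ring.
  rewrite [Num.sqrt (v * _)]sqrtrM ?(ltW v0)//.
  rewrite (_ : - (_ * _) = - (z - m i) ^+ 2 / (2 * v *+ 2)); last first.
    by rewrite mulNr; congr (- (_ * _^-1)); ring.
  have sv : Num.sqrt v != 0 by rewrite gt_eqF// sqrtr_gt0.
  have sp : Num.sqrt (4 * pi) != 0 :> R by rewrite gt_eqF// sqrtr_gt0 mulr_gt0// pi_gt0.
  set A := expR 4^-1; set B := expR (- _ / _); set C := Num.sqrt v in sv *.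
  set D := Num.sqrt _ in sp *.
  by field; rewrite sp.
under eq_integral do rewrite E EFinM.
rewrite ge0_integralZl_EFin//.
- by rewrite integral_normal_pdf// mule1.
- by move=> z _; rewrite lee_fin normal_pdf_ge0.
- by apply/measurable_EFinP; exact: measurable_normal_pdf.
- by rewrite !mulr_ge0// ?expR_ge0// ltW.
Qed.

Lemma measurable_gauss t : measurable_fun setT (gauss t).
Proof.
apply: measurableT_comp => //; apply: measurable_sum => i.
have ml : measurable_fun setT (log_gauss i t).
  apply: measurable_funB => //; apply: measurable_funM => //.
  by apply: measurable_funX => //; exact: measurable_funB.
exact: (measurableT_comp ml (@measurable_rV_coord R N i)).
Qed.

Lemma integral_gauss t : 0 <= t ->
  (\int[lebesgue_rV R N]_x (gauss t x)%:E =
   ((expR 4^-1 * Num.sqrt (4 * pi)) ^+ N * \prod_i d i)%:E)%E.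
Proof.
move=> t0.
under eq_integral do rewrite /gauss expR_sum.
rewrite (@integral_rV_prod _ _ (fun i z => expR (log_gauss i t z))); last 2 first.
- move=> i; apply: measurableT_comp => //; apply: measurable_funB => //.
  apply: measurable_funM => //; apply: measurable_funX => //.
  exact: measurable_funB.
- by move=> i z; exact: expR_ge0.
rewrite (eq_bigr (fun i => ((expR 4^-1 * Num.sqrt (4 * pi)) * d i)%:E)); last first.
  by move=> i _; exact: integral_log_gauss.
by rewrite prodEFin big_split/= prodr_const card_ord.
Qed.

End gaussian.
End supersolutions.

(** * The Dirichlet heat kernel *)

Section fatou_bound.
Local Open Scope ereal_scope.
Context {d} {T : measurableType d} {R : realType} (mu : {measure set T -> \bar R}).

Lemma fatou_le (f : nat -> T -> \bar R) (g : T -> \bar R) (M : \bar R) :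
  (forall n, measurable_fun setT (f n)) -> (forall n x, 0 <= f n x) ->
  (forall x, f ^~ x @ \oo --> g x) -> (forall n, \int[mu]_x f n x <= M) ->
  \int[mu]_x g x <= M.
Proof.
move=> mf f0 fg fM.
have -> : \int[mu]_x g x = \int[mu]_x limn_einf (f^~ x).
  by apply: eq_integral => x _; rewrite (cvg_limn_einf_sup (fg x)).1.
apply: le_trans (fatou mu measurableT mf (fun n x _ => f0 n x)) _.
rewrite limn_einf_lim; apply: lime_le; first exact: is_cvg_einfs.
apply: nearW => n; apply: le_trans (fM n).
by apply: ereal_inf_lbound; exists n => /=.
Qed.

End fatou_bound.

Lemma continuous_measurable_rV {R : realType} {N : nat} (f : 'rV[R]_N -> R) :
  continuous f -> measurable_fun setT f.
Proof.
move=> cf; apply: (measurability _ (RGenOpens.measurableE R)) => //.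
move=> _ [_ [a [b ->] <-]]; rewrite setTI; apply: open_measurable_rV.
by apply: open_comp; [move=> x _; exact: cf|exact: interval_open].
Qed.

Lemma heat_solution_cvg0 {R : realType} {N : nat} (Omega : set 'rV[R]_N) f u
    (t_ : nat -> R) x : dirichlet_heat_solution Omega f u ->
  (forall n, 0 < t_ n) -> t_ @ \oo --> (0 : R) -> Omega x ->
  u (t_ n) x @[n --> \oo] --> f x.
Proof.
move=> [cu _ _ _ u0] tpos tcvg Ox; rewrite -(u0 _ Ox).
pose A := [set p : R * 'rV[R]_N | 0 <= p.1 /\ closure Omega p.2].
have A0 : A (0, x) by split => //=; exact: subset_closure.
have H := (subspace_continuousP A (fun p => u p.1 p.2)).1 cu (0, x) A0.
have tA : (fun n => (t_ n, x)) @ \oo --> within A (nbhs ((0 : R), x)).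
  have tx : (fun n => (t_ n, x)) @ \oo --> ((0 : R), x).
    have cx : (fun=> x) @ \oo --> x by exact: cvg_cst.
    exact: (cvg_pair tcvg cx).
  move=> W /tx HW; have {}HW : \forall n \near \oo, A (t_ n, x) -> W (t_ n, x) := HW.
  suff : \forall n \near \oo, W (t_ n, x) by [].
  by apply: filterS HW => n; apply; split => /=; [exact: ltW|exact: subset_closure].
exact: (cvg_comp (fun n => (t_ n, x)) (fun p => u p.1 p.2) tA H).
Qed.

(** * Mass bounds for the kernel in each variable *)

Section kernel.
Context {R : realType} {N : nat}.
Variables (Omega : set 'rV[R]_N) (K : R -> 'rV[R]_N -> 'rV[R]_N -> R).
Hypotheses (oO : open Omega) (hK : dirichlet_heat_kernel Omega K).
Local Notation V := 'rV[R]_N.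
Local Notation mu := (lebesgue_rV R N).
Local Open Scope ereal_scope.

(** [K] is unconstrained outside positive times and Omega; extension by 0 makes the hypotheses on
    abstract kernels hold for all t, x and y. *)
Definition ker (t : R) (x y : V) : \bar R :=
  if `[< [/\ 0 < t, Omega x & Omega y] >]%R then (K t x y)%:E else 0.

Lemma kerE t x y : (0 < t)%R -> Omega x -> Omega y -> ker t x y = (K t x y)%:E.
Proof. by move=> t0 Ox Oy; rewrite /ker; case: asboolP => // -[]. Qed.

Lemma ker_outl t x y : ~ Omega x -> ker t x y = 0.
Proof. by move=> nO; rewrite /ker; case: asboolP => // -[]. Qed.

Lemma ker_outr t x y : ~ Omega y -> ker t x y = 0.
Proof. by move=> nO; rewrite /ker; case: asboolP => // -[]. Qed.

Lemma ker_ge0 t x y : 0 <= ker t x y.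
Proof.
have [_ K0 _ _] := hK.
by rewrite /ker; case: asboolP => // -[t0 Ox Oy]; rewrite lee_fin K0.
Qed.

Lemma measurable_ker : measurable_fun setT
  (fun p : measurableTypeR R * (V * V) => ker p.1 p.2.1 p.2.2).
Proof.
have [mK _ _ _] := hK.
pose D : set (measurableTypeR R * (V * V)) := [set t | 0 < t]%R `*` (Omega `*` Omega).
have mO := open_measurable_rV oO.
have mD : measurable D.
  apply: measurableX; last exact: measurableX.
  rewrite (_ : [set t | 0 < t]%R = `]0%R, +oo[%classic); first exact: measurable_itv.
  by apply/seteqP; split => t; rewrite /= in_itv/= andbT.
have mKE : measurable_fun D (fun p : measurableTypeR R * (V * V) => (K p.1 p.2.1 p.2.2)%:E).
  by apply/measurable_EFinP; exact: mK.
apply: eq_measurable_fun ((measurable_restrictT _ mD).1 mKE).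
move=> -[t [x y]] _ /=; rewrite /ker patchE.
case: asboolP => [[t0 Ox Oy]|nD]; first by rewrite mem_set.
by rewrite memNset// => -[/= ? [? ?]]; apply: nD.
Qed.

Lemma heat_op_ker t f x : (0 < t)%R -> Omega x ->
  heat_op Omega K t f x = kop mu ker t f x.
Proof.
move=> t0 Ox; rewrite /heat_op /kop integral_mkcond; apply: eq_integral => y _.
rewrite patchE; case: ifPn => [|]; first by rewrite inE => Oy; rewrite kerE.
by rewrite notin_setE => nO; rewrite ker_outr// mul0e.
Qed.

Lemma kop_outl t f x : ~ Omega x -> kop mu ker t f x = 0.
Proof.
by move=> nO; rewrite /kop; under eq_integral do rewrite ker_outl// mul0e; exact: integral0.
Qed.

Lemma kerD (s t : R) (x z : V) : (0 < s)%R -> (0 < t)%R ->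
  ker (s + t) x z = \int[mu]_y (ker s x y * ker t y z).
Proof.
move=> s0 t0; have [_ _ KD _] := hK.
have [Ox|nOx] := pselect (Omega x); last by rewrite ker_outl// -/(kop mu ker s _ x) kop_outl.
have [Oz|nOz] := pselect (Omega z); last first.
  rewrite ker_outr//; under eq_integral do rewrite (ker_outr _ _ nOz) mule0.
  by rewrite integral0.
rewrite kerE ?addr_gt0// KD// heat_op_ker//; apply: eq_integral => y _.
have [Oy|nOy] := pselect (Omega y); first by rewrite (kerE t0 Oy Oz).
by rewrite (ker_outr _ _ nOy) !mul0e.
Qed.

(** The kernel is tied to the heat equation only through C_c(Omega). Functions of C_c(O) between 0
    and 1 converge pointwise to 1_O; each heat solution lies below [w] by comparison, and Fatou's
    lemma passes to the limit. *)
Lemma ker_open_le (O : set V) w t x : open O -> O `<=` Omega ->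
  heat_supersolution w -> (forall y, O y -> 1 <= w 0 y)%R ->
  (0 < t)%R -> Omega x ->
  \int[mu]_y (ker t x y * (\1_O y)%:E) <= (w t x)%:E.
Proof.
move=> openO OO sw w1 t0 Ox.
have [g [Cg g01 gO gto1]] := Cc_exhaustion openO.
have mg n : measurable_fun setT (fun y => (g n y)%:E).
  by apply/measurable_EFinP; have [cg _] := Cg n; exact: continuous_measurable_rV.
have mkx : measurable_fun setT (ker t x) by exact: (measurable_kx measurable_ker).
apply: (@fatou_le _ _ _ _ (fun n y => ker t x y * (g n y)%:E)).
- by move=> n; exact: emeasurable_funM.
- by move=> n y; rewrite mule_ge0 ?ker_ge0// lee_fin; case/andP: (g01 n y).
- move=> y; apply: cvg_near_cst; have [Oy|nOy] := pselect (O y).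
    have [k0 Hk] := gto1 y Oy; near=> n.
    rewrite indicE mem_set// Hk//; near: n; exact: nbhs_infty_ge.
  by near=> n; rewrite indicE memNset// gO.
move=> n; have CgO : Cc Omega (g n).
  have [cg [A [cA AO gA]]] := Cg n; split => //; exists A; split => //.
  exact: subset_trans OO.
have [_ _ _ Kheat] := hK.
have [u [ug uE]] := Kheat _ CgO.
have := uE t x t0 Ox; rewrite heat_op_ker// /kop => <-.
rewrite lee_fin; apply: (le_heat_supersolution oO ug sw) => //; last exact: ltW.
move=> y _; have [Oy|nOy] := pselect (O y).
  by apply: le_trans (w1 _ Oy); case/andP: (g01 n y).
by rewrite gO//; have [w0 _ _] := sw; exact: w0.
Unshelve. all: by end_near. Qed.

Lemma ker_le1 t x : \int[mu]_y ker t x y <= 1.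
Proof.
have [[t0 Ox]|nP] := pselect ((0 < t)%R /\ Omega x); last first.
  rewrite (_ : ker t x = cst 0); first by rewrite integral0.
  by apply/funext => y; rewrite /ker; case: asboolP => // -[? ? _]; exfalso; apply: nP.
have := @ker_open_le Omega _ t x oO (@subset_refl _ Omega) heat_supersolution1
  (fun _ _ => lexx 1%R) t0 Ox.
apply: le_trans; rewrite le_eqVlt; apply/orP; left; apply/eqP.
apply: eq_integral => y _; have [Oy|nOy] := pselect (Omega y).
  by rewrite indicE mem_set// mule1.
by rewrite (ker_outr _ _ nOy) mul0e.
Qed.

Lemma open_rat_box (a b : 'rV[rat]_N) : open (rat_box a b : set V).
Proof.
rewrite openE => x xab.
exists (fun _ j => `]ratr (a ord0 j), ratr (b ord0 j)[%classic).
  by move=> i j; rewrite (ord1 i); apply: near_in_itvoo; rewrite in_itv/=; exact: xab.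
by move=> y yab j; have := yab ord0 j; rewrite /= in_itv.
Qed.

(** Mass of the Gaussian with half-widths d_i divided by the volume of the box, the product of the 2
    * d_i; the d_i cancel. *)
Definition marginal_bound : R := ((expR 4^-1 * Num.sqrt (4 * pi)) / 2) ^+ N.

Lemma marginal_bound_ge0 : (0 <= marginal_bound)%R.
Proof. by rewrite exprn_ge0// divr_ge0// mulr_ge0// expR_ge0. Qed.

Lemma measurable_kerl t y : measurable_fun setT (ker t ^~ y).
Proof.
apply: (measurable_k measurable_ker (h := fun=> t : measurableTypeR R) (a := id) (b := fun=> y)) => //.
Qed.

Lemma measurable_ker2 t : measurable_fun setT (fun p : V * V => ker t p.2 p.1).
Proof.
exact: (measurable_k measurable_ker (h := fun=> t : measurableTypeR R) (a := snd) (b := fst)).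
Qed.

(* The box is dominated at time [0] by a product of one-dimensional Gaussians
   with comparable mass; anisotropic boxes cost nothing since the coordinates
   of a product solution may have different variances. *)
Lemma ker_marginal t : (0 < t)%R ->
  \forall y \ae mu, \int[mu]_x ker t x y <= marginal_bound%:E.
Proof.
move=> t0; apply: ae_le_density_rV.
- exact: (measurable_fun_fubini_tonelli_F (fun p : V * V => ker t p.2 p.1)
    (measurable_ker2 t) (fun=> ker_ge0 _ _ _)).
- by move=> y; apply: integral_ge0 => x _; exact: ker_ge0.
- exact: marginal_bound_ge0.
move=> a b ab.
pose m i : R := ((ratr (a ord0 i) + ratr (b ord0 i)) / 2)%R.
pose d i : R := ((ratr (b ord0 i) - ratr (a ord0 i)) / 2)%R.
have d0 i : (0 < d i)%R by rewrite divr_gt0// subr_gt0 ltr_rat.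
have mB := @measurable_rat_box R N a b.
have mind : measurable_fun setT (fun y : V => (\1_(rat_box a b) y : R)%:E).
  by apply/measurable_EFinP; exact: measurable_indic.
rewrite integral_mkcond.
rewrite (eq_integral (fun y => \int[mu]_x (ker t x y * (\1_(rat_box a b) y)%:E))); last first.
  move=> y _; rewrite patchE ge0_integralZr//.
  - by rewrite indicE; case: ifP => _; rewrite ?mule1 ?mule0.
  - exact: measurable_kerl.
  - by move=> x _; exact: ker_ge0.
have mk2 : measurable_fun setT (fun p : V * V => ker t p.2 p.1 * (\1_(rat_box a b) p.1)%:E).
  apply: emeasurable_funM; first exact: measurable_ker2.
  exact: (measurableT_comp mind measurable_fst).
have k20 (p : V * V) : 0 <= ker t p.2 p.1 * (\1_(rat_box a b) p.1)%:E.
  by rewrite mule_ge0 ?ker_ge0// lee_fin.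
(* After the exchange, the integral of the marginal over the box is the integral over x of S(t)
   applied to the indicator of the box, which lies below the Gaussian. *)
rewrite (fubini_tonelli (m1 := mu) (m2 := mu) _ mk2 k20) /=.
apply: (@le_trans _ _ (\int[mu]_x (gauss m d t x)%:E)).
  apply: ge0_le_integral => //.
  - by move=> x _; apply: integral_ge0 => y _; rewrite mule_ge0 ?ker_ge0// lee_fin.
  - exact: (measurable_fun_fubini_tonelli_G _ mk2 k20).
  - by apply/measurable_EFinP; exact: measurable_gauss.
  - move=> x _; have [Ox|nOx] := pselect (Omega x); last first.
      under eq_integral do rewrite (ker_outl _ _ nOx) mul0e.
      by rewrite integral0 lee_fin expR_ge0.
    have oB : open (Omega `&` rat_box a b) by apply: openI => //; exact: open_rat_box.
    have := @ker_open_le (Omega `&` rat_box a b) (gauss m d) t x oB (@subIsetl _ _ _)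
      (heat_supersolution_gauss m d0).
    have gB y : (Omega `&` rat_box a b) y -> (1 <= gauss m d 0 y)%R.
      move=> [_ yab]; apply: gauss0_ge1 => // i.
      by have /andP[ya yb] := yab i; rewrite ler_norml /m /d; apply/andP; split; lra.
    move=> /(_ gB t0 Ox); apply: le_trans.
    rewrite le_eqVlt; apply/orP; left; apply/eqP; apply: eq_integral => y _.
    have [Oy|nOy] := pselect (Omega y); last by rewrite (ker_outr _ _ nOy) !mul0e.
    by rewrite !indicE in_setI (mem_set Oy).
rewrite integral_gauss ?(ltW t0)// lee_fin /marginal_bound /d.
by rewrite big_split/= prodr_const card_ord [in leRHS]exprMn [in leRHS]mulrAC mulrA lexx.
Qed.

Lemma kop_Cc_cvg0 (g : V -> R) (t_ : nat -> R) x : Cc Omega g ->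
  (forall n, 0 < t_ n)%R -> t_ @ \oo --> (0%R : R) -> Omega x ->
  kop mu ker (t_ n) (EFin \o g) x @[n --> \oo] --> (g x)%:E.
Proof.
move=> Cg tpos tcvg Ox; have [_ _ _ Kheat] := hK.
have [u [ug uE]] := Kheat _ Cg.
rewrite (_ : (fun n => _) = EFin \o (fun n => u (t_ n) x)); last first.
  by apply/funext => n; rewrite /= -heat_op_ker// -uE.
apply: cvg_EFin; first exact: nearW.
exact: heat_solution_cvg0 ug tpos tcvg Ox.
Qed.

End kernel.

(** * Small times *)

Section weak_convergence.
Context {d} {X : measurableType d} {R : realType} (mu : {measure set X -> \bar R}).
Variables (V : set X) (C : R) (kap : nat -> X -> R) (kap0 : X -> R).
Hypotheses (mV : measurable V) (Vfin : (mu V < +oo)%E) (C_ge0 : 0 <= C).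
Hypotheses (mkap : forall n, measurable_fun setT (kap n))
  (mkap0 : measurable_fun setT kap0).
Hypotheses (kapC : forall n x, `|kap n x| <= C) (kap0C : forall x, `|kap0 x| <= C).

Definition weak_cvg (h : X -> R) :=
  (fun n => \int[mu]_(x in V) (kap n x * h x)) @ \oo -->
  \int[mu]_(x in V) (kap0 x * h x).

Lemma le_bounded_integrable (h : X -> R) (B : R) : measurable_fun setT h ->
  (forall x, `|h x| <= B) -> mu.-integrable V (EFin \o h).
Proof.
move=> mh hB; apply: measurable_bounded_integrable => //; first exact: measurable_funTS.
exists B; split; first exact: num_real.
by move=> M BM x _ /=; apply: le_trans (hB x) (ltW BM).
Qed.

Lemma integrableM_bounded (f h : X -> R) : measurable_fun setT f ->
  measurable_fun setT h -> (forall x, `|f x| <= C) -> (forall x, `|h x| <= 1) ->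
  mu.-integrable V (EFin \o (fun x => f x * h x)).
Proof.
move=> mf mh fC h1; apply: (@le_bounded_integrable _ C); first exact: measurable_funM.
by move=> x; rewrite normrM -[C]mulr1; apply: ler_pM.
Qed.

Lemma le_norm_RintegralB (f h h' : X -> R) : measurable_fun setT f ->
  measurable_fun setT h -> measurable_fun setT h' -> (forall x, `|f x| <= C) ->
  (forall x, `|h x| <= 1) -> (forall x, `|h' x| <= 1) ->
  `|\int[mu]_(x in V) (f x * h x) - \int[mu]_(x in V) (f x * h' x)|
    <= C * \int[mu]_(x in V) `|h x - h' x|.
Proof.
move=> mf mh mh' fC h1 h'1.
have mB : measurable_fun setT (fun x => h x - h' x) by exact: measurable_funB.
have hB x : `|h x - h' x| <= 2.
  by apply: le_trans (ler_normB _ _) _; have := h1 x; have := h'1 x; lra.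
have i1 : mu.-integrable V (EFin \o (fun x => `|h x - h' x|)).
  apply: (@le_bounded_integrable _ 2); first exact: measurableT_comp.
  by move=> x; rewrite normr_id.
have i2 : mu.-integrable V (EFin \o (fun x => f x * (h x - h' x))).
  apply: (@le_bounded_integrable _ (C * 2)); first exact: measurable_funM.
  by move=> x; rewrite normrM; apply: ler_pM.
rewrite -RintegralB//; [|exact: integrableM_bounded|exact: integrableM_bounded].
under eq_Rintegral do rewrite -mulrBr.
apply: le_trans (le_normr_Rintegral _ i2) _ => //.
rewrite -RintegralZl//; apply: le_Rintegral => //.
- apply: (@le_bounded_integrable _ (C * 2)).
    by apply: measurableT_comp => //; exact: measurable_funM.
  by move=> x; rewrite normr_id normrM; apply: ler_pM.
- apply: (@le_bounded_integrable _ (C * 2)).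
    by apply: measurable_funM => //; exact: measurableT_comp.
  by move=> x; rewrite normrM normr_id (ger0_norm C_ge0) ler_wpM2l.
- by move=> x _; rewrite normrM ler_wpM2r.
Qed.

(** Replacing h by h_j changes every integral, including the limiting one, by at most C times the
    integral of |h - h_j| over V. This error is uniform in n and tends to 0 with j by dominated
    convergence, V having finite measure. *)
Lemma weak_cvg_limit (h_ : nat -> X -> R) (h : X -> R) :
  (forall j, measurable_fun setT (h_ j)) -> measurable_fun setT h ->
  (forall j x, `|h_ j x| <= 1) -> (forall x, `|h x| <= 1) ->
  (forall x, V x -> h_ ^~ x @ \oo --> h x) ->
  (forall j, weak_cvg (h_ j)) -> weak_cvg h.
Proof.
move=> mh_ mh h_1 h1 h_h wh_.
have mB j : measurable_fun setT (fun x => `|h x - h_ j x|).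
  by apply: measurableT_comp => //; exact: measurable_funB.
have hB j x : `|h x - h_ j x| <= 2.
  by apply: le_trans (ler_normB _ _) _; have := h1 x; have := h_1 j x; lra.
pose del j := \int[mu]_(x in V) `|h x - h_ j x|.
have del0 : del @ \oo --> (0 : R).
  have m1 j : measurable_fun V (fun x => `|h x - h_ j x|%:E).
    by apply: measurable_funTS; exact/measurable_EFinP.
  have c1 : \forall x \ae mu, V x ->
      (fun j => `|h x - h_ j x|%:E) @ \oo --> (cst 0%E : X -> \bar R) x.
    apply: aeW => x Vx; apply: cvg_EFin; first exact: nearW.
    have hx : (fun=> h x) @ \oo --> h x by exact: cvg_cst.
    by have := cvg_norm (cvgB hx (h_h x Vx)); rewrite subrr normr0 => H; exact: H.
  have i1 : mu.-integrable V (cst 2%:E : X -> \bar R).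
    by apply: (@le_bounded_integrable (cst 2) 2) => // x; rewrite ger0_norm.
  have b1 : \forall x \ae mu, forall j, V x -> (`| `|h x - h_ j x|%:E | <= cst 2%:E x)%E.
    by apply: aeW => x j _; rewrite /= lee_fin normr_id.
  have [_ _] := dominated_convergence mV m1 (measurable_cst 0%E) c1 i1 b1.
  by rewrite integral0 => /fine_cvg.
apply/cvgrPdist_le => e e0.
(* Two replacement errors and one convergence error share e; C + 1 keeps the division legitimate
   when C = 0. *)
pose e' := e / (3 * (C + 1)).
have e'0 : 0 < e' by rewrite divr_gt0// mulr_gt0// ltr_wpDl.
have Ce' : C * e' <= e / 3.
  have C1 : 0 < C + 1 by rewrite ltr_wpDl.
  rewrite /e' (_ : C * _ = e / 3 * (C / (C + 1))); last by field; rewrite gt_eqF.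
  rewrite ler_piMr//; first by rewrite divr_ge0// ltW.
  by rewrite ler_pdivrMr// mul1r; lra.
have [j _ /(_ j (leqnn j))] := cvgr0_norm_le _ del0 _ e'0.
rewrite ger0_norm; last by apply: Rintegral_ge0.
move=> delj.
have e3 : 0 < e / 3 by rewrite divr_gt0.
have /cvgrPdist_le/(_ _ e3) := wh_ j.
apply: filterS => n Hn.
have a1 := le_norm_RintegralB mkap0 mh (mh_ j) kap0C h1 (h_1 j).
have a2 := le_norm_RintegralB (mkap n) mh (mh_ j) (kapC n) h1 (h_1 j).
have cd : C * del j <= e / 3 by apply: le_trans Ce'; exact: ler_wpM2l.
rewrite -/(del j) in a1 a2.
set A := \int[mu]_(x in V) (kap0 x * h x) in a1 *.
set A' := \int[mu]_(x in V) (kap0 x * h_ j x) in a1 Hn.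
set B := \int[mu]_(x in V) (kap n x * h x) in a2 *.
set B' := \int[mu]_(x in V) (kap n x * h_ j x) in a2 Hn.
rewrite (_ : A - B = (A - A') + (A' - B') + (B' - B)); last by ring.
apply: le_trans (ler_normD _ _) _; rewrite (distrC B' B).
by have := ler_normD (A - A') (A' - B'); lra.
Qed.

Lemma weak_cvgB (h h' : X -> R) : measurable_fun setT h -> measurable_fun setT h' ->
  (forall x, `|h x| <= 1) -> (forall x, `|h' x| <= 1) ->
  weak_cvg h -> weak_cvg h' -> weak_cvg (fun x => h x - h' x).
Proof.
move=> mh mh' h1 h'1 wh wh'; rewrite /weak_cvg.
under eq_Rintegral do rewrite mulrBr.
rewrite RintegralB//; [|exact: integrableM_bounded|exact: integrableM_bounded].
rewrite (_ : (fun n => _) = (fun n => \int[mu]_(x in V) (kap n x * h x) -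
    \int[mu]_(x in V) (kap n x * h' x))); first exact: cvgB.
apply/funext => n; under eq_Rintegral do rewrite mulrBr.
by rewrite RintegralB//; exact: integrableM_bounded.
Qed.

End weak_convergence.

(** * From C_c to Borel sets, and the semigroup on an indicator at small times *)

Section small_time.
Context {R : realType} {N : nat}.
Local Notation mu := (lebesgue_rV R N).
Local Notation X := 'rV[R]_N.

Lemma indic_norm_le1 (A : set X) x : `|\1_A x : R| <= 1.
Proof. by rewrite indicE; case: (_ \in _); rewrite ?normr1 ?normr0. Qed.

(** Borel sets whose indicators are valid test functions form a lambda-system: proper differences by
    linearity, increasing unions by [weak_cvg_limit]. An open U enters through functions of C_c(U
    [&] V), which suffice because integrals run over V. *)
Lemma weak_cvg_sets (V : set X) (C : R) (kap : nat -> X -> R) (kap0 : X -> R) :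
  open V -> (mu V < +oo)%E -> 0 <= C ->
  (forall n, measurable_fun setT (kap n)) -> measurable_fun setT kap0 ->
  (forall n x, `|kap n x| <= C) -> (forall x, `|kap0 x| <= C) ->
  (forall g, Cc V g -> (forall y, 0 <= g y <= 1) -> weak_cvg mu V kap kap0 g) ->
  forall B, measurable B -> weak_cvg mu V kap kap0 (\1_B : X -> R).
Proof.
move=> oV Vfin C0 mkap mkap0 kapC kap0C HCc B mB.
have mV := open_measurable_rV oV.
pose D := [set A : set X | measurable A /\ weak_cvg mu V kap kap0 (\1_A : X -> R)].
suff : D B by case.
have DU U : open U -> D U.
  move=> oU; have mU := open_measurable_rV oU; split => //.
  have [g [Cg g01 gO gto1]] := Cc_exhaustion (openI oU oV).
  apply: (weak_cvg_limit mV Vfin C0 mkap mkap0 kapC kap0C (h_ := g)) => //.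
  - by move=> j; have [cg _] := Cg j; exact: continuous_measurable_rV.
  - by move=> j x; have /andP[g0 g1] := g01 j x; rewrite ger0_norm.
  - exact: indic_norm_le1.
  - move=> x Vx; apply: cvg_near_cst; have [Ux|nUx] := pselect (U x).
      have [k0 Hk] := gto1 x (conj Ux Vx); near=> n.
      by rewrite indicE mem_set// Hk//; near: n; exact: nbhs_infty_ge.
    by near=> n; rewrite indicE memNset// gO// => -[].
  - move=> j; apply: HCc; last exact: g01.
    have [cg [A [cA AUV gA]]] := Cg j; split => //; exists A; split => //.
    by move=> x /AUV[].
apply: (rV_lambda_system _ DU) => //; split => //.
- by apply: DU; exact: openT.
- move=> A A' A'A [mA wA] [mA' wA']; split; first exact: measurableD.
  have -> : \1_(A `\` A') = (fun x => \1_A x - \1_A' x) :> (X -> R).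
    apply/funext => x; rewrite !indicE in_setD.
    have [xA'|xA'] := boolP (x \in A'); last by rewrite subr0 andbT.
    by rewrite andbF (_ : x \in A) ?subrr//; move: xA'; rewrite !inE; exact: A'A.
  by apply: (weak_cvgB mV Vfin mkap mkap0 kapC kap0C (h := \1_A) (h' := \1_A')) => //;
    exact: indic_norm_le1.
- move=> F ndF DF; split; first by apply: bigcup_measurable => k _; case: (DF k).
  apply: (weak_cvg_limit mV Vfin C0 mkap mkap0 kapC kap0C (h_ := fun j => \1_(F j))).
  - by move=> j; apply: measurable_indic; case: (DF j).
  - by apply: measurable_indic; apply: bigcup_measurable => k _; case: (DF k).
  - by move=> j x; exact: indic_norm_le1.
  - exact: indic_norm_le1.
  - move=> x _; apply: cvg_near_cst; have [[k _ Fkx]|nF] := pselect ((\bigcup_k F k) x).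
      near=> n; rewrite !indicE !mem_set//; first by exists k.
      have kn : (k <= n)%N by near: n; exact: nbhs_infty_ge.
      by move: Fkx; apply/subsetPset; exact: ndF.
    near=> n; rewrite !indicE !memNset// => Fnx; apply: nF; by exists n.
  - by move=> j; case: (DF j).
Unshelve. all: by end_near. Qed.

Variables (Omega : set X) (K : R -> X -> X -> R).
Hypotheses (oO : open Omega) (hK : dirichlet_heat_kernel Omega K).
Local Notation ker := (ker Omega K).
Local Notation kop := (kop mu ker).
Let mker := measurable_ker oO hK.
Let ker0 := ker_ge0 hK.

Variables (E V : set X).
Hypotheses (mE : measurable E) (oV : open V) (EV : E `<=` V) (VO : V `<=` Omega)
  (Vfin : (mu V < +oo)%E).
Local Notation C := (@marginal_bound R N + 1)%R.
Local Open Scope ereal_scope.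

Let Efin : mu E < +oo.
Proof.
apply: le_lt_trans Vfin; apply: le_measure => //; rewrite inE//.
exact: open_measurable_rV.
Qed.

Let mEE : measurable_fun setT (fun x : X => (\1_E x : R)%:E).
Proof. by apply/measurable_EFinP; exact: measurable_indic. Qed.

(** The adjoint of S(t) applied to 1_E. *)
Definition marginal t y := \int[mu]_x ((\1_E x)%:E * ker t x y).

(** The bound on the marginal holds for almost every y only; truncation makes it hold everywhere
    without changing integrals at positive times. The level is [marginal_bound] plus 1 so as to
    bound the limit 1_E too. *)
Definition cut_marginal t y : R := fine (mine (marginal t y) C%:E).

Lemma cutoff_ge1 : (1 <= C)%R.
Proof. by rewrite lerDr marginal_bound_ge0. Qed.

Lemma marginal_ge0 t y : 0 <= marginal t y.
Proof. by apply: integral_ge0 => x _; rewrite mule_ge0 ?ker0// lee_fin. Qed.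

Lemma measurable_indic_ker t : measurable_fun setT
  (fun p : X * X => (\1_E p.2)%:E * ker t p.2 p.1).
Proof.
apply: emeasurable_funM; last exact: measurable_ker2.
exact: (measurableT_comp mEE measurable_snd).
Qed.

Lemma measurable_marginal t : measurable_fun setT (marginal t).
Proof.
apply: (measurable_fun_fubini_tonelli_F _ (measurable_indic_ker t)) => p.
by rewrite mule_ge0 ?ker0// lee_fin.
Qed.

Lemma cut_marginalE t : (0 < t)%R ->
  \forall y \ae mu, (cut_marginal t y)%:E = marginal t y.
Proof.
move=> t0; have := ker_marginal oO hK t0.
apply: (@filterS _ _ (ae_filter_ringOfSetsType _)) => y Hy.
have HC : marginal t y <= C%:E.
  apply: (@le_trans _ _ (\int[mu]_x ker t x y)).
    apply: ge0_le_integral => //.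
    - by move=> x _; rewrite mule_ge0 ?ker0// lee_fin.
    - by apply: emeasurable_funM => //; exact: measurable_kerl.
    - exact: measurable_kerl.
    - move=> x _; rewrite -[leRHS]mul1e lee_wpmul2r ?ker0// lee_fin.
      by rewrite indicE; case: (_ \in _).
  by apply: le_trans Hy _; rewrite lee_fin lerDl.
rewrite /cut_marginal min_l// fineK// ge0_fin_numE ?marginal_ge0//.
by apply: le_lt_trans HC _; rewrite ltry.
Qed.

Lemma cut_marginal_bound t y : (`|cut_marginal t y| <= C)%R.
Proof.
have C0 : (0 <= C)%R by apply: le_trans cutoff_ge1.
have m0 : 0 <= mine (marginal t y) C%:E by rewrite le_min marginal_ge0 lee_fin.
have mC : mine (marginal t y) C%:E <= C%:E by rewrite ge_min lexx orbT.
rewrite /cut_marginal ger0_norm ?fine_ge0// -lee_fin fineK//.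
by rewrite ge0_fin_numE//; apply: le_lt_trans mC _; rewrite ltry.
Qed.

Lemma measurable_cut_marginal t : measurable_fun setT (cut_marginal t).
Proof.
apply: measurableT_comp => //; apply: measurable_mine => //.
exact: measurable_marginal.
Qed.

(** Duality by Tonelli: pairing h with the adjoint image of 1_E equals integrating S(t) h over E. *)
Lemma Rintegral_cut_marginal t (h : X -> R) : (0 < t)%R -> measurable_fun setT h ->
  (forall y, 0 <= h y)%R -> (forall y, ~ V y -> h y = 0%R) ->
  (\int[mu]_(y in V) (cut_marginal t y * h y))%R =
  fine (\int[mu]_(x in E) kop t (EFin \o h) x).
Proof.
move=> t0 mh h0 hV; rewrite /Rintegral; congr fine.
have mhE : measurable_fun setT (EFin \o h) by exact/measurable_EFinP.
rewrite [RHS]integral_mkcond [LHS]integral_mkcond.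
transitivity (\int[mu]_y \int[mu]_x ((\1_E x)%:E * ker t x y * (h y)%:E)).
  have mI : measurable_fun setT (fun y => \int[mu]_x ((\1_E x)%:E * ker t x y * (h y)%:E)).
    apply: (measurable_fun_fubini_tonelli_F
      (fun p : X * X => (\1_E p.2)%:E * ker t p.2 p.1 * (h p.1)%:E)) => //.
      apply: emeasurable_funM; first exact: measurable_indic_ker.
      exact: (measurableT_comp mhE measurable_fst).
    by move=> p; rewrite !mule_ge0 ?ker0// lee_fin// h0.
  apply: ae_eq_integral => //.
    apply/(measurable_restrictT _ (open_measurable_rV oV)); apply: measurable_funTS.
    by apply/measurable_EFinP; apply: measurable_funM => //; exact: measurable_cut_marginal.
  have := cut_marginalE t0.
  apply: (@filterS _ _ (ae_filter_ringOfSetsType _)) => y Hy _.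
  rewrite ge0_integralZr//.
  - rewrite -/(marginal t y) -Hy patchE -EFinM; case: ifPn => //.
    by rewrite notin_setE => /hV ->; rewrite mulr0.
  - by apply: emeasurable_funM => //; exact: measurable_kerl.
  - by move=> x _; rewrite mule_ge0 ?ker0// lee_fin.
  - by rewrite lee_fin.
have mEkh : measurable_fun setT (fun p : X * X => (\1_E p.2)%:E * ker t p.2 p.1 * (h p.1)%:E).
  apply: emeasurable_funM; first exact: measurable_indic_ker.
  exact: (measurableT_comp mhE measurable_fst).
have Ekh0 (p : X * X) : 0 <= (\1_E p.2)%:E * ker t p.2 p.1 * (h p.1)%:E.
  by rewrite !mule_ge0 ?ker0// lee_fin// h0.
rewrite (fubini_tonelli (m1 := mu) (m2 := mu) _ mEkh Ekh0) /=.
apply: eq_integral => x _; rewrite patchE indicE.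
case: ifP => _; last by under eq_integral do rewrite mul0e mul0e; rewrite integral0.
by apply: eq_integral => y _; rewrite mul1e.
Qed.

Lemma kop_le1 t (h : X -> R) x : measurable_fun setT h -> (forall y, 0 <= h y <= 1)%R ->
  kop t (EFin \o h) x <= 1.
Proof.
move=> mh h01; apply: le_trans (ker_le1 oO hK t x).
have mkx : measurable_fun setT (ker t x) by exact: (measurable_kx mker).
apply: ge0_le_integral => //.
- by move=> y _; rewrite mule_ge0 ?ker0// lee_fin; case/andP: (h01 y).
- by apply: emeasurable_funM => //; exact/measurable_EFinP.
- move=> y _; rewrite -[leRHS]mule1 lee_wpmul2l ?ker0// lee_fin.
  by case/andP: (h01 y).
Qed.

Lemma Rintegral_indicM (h : X -> R) : measurable_fun setT h ->
  (forall y, 0 <= h y <= 1)%R ->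
  (\int[mu]_(x in V) (\1_E x * h x))%R%:E = \int[mu]_(x in E) (h x)%:E.
Proof.
move=> mh h01; have mhE : measurable_fun E (EFin \o h).
  by apply: measurable_funTS; exact/measurable_EFinP.
have h0 x : 0 <= (h x)%:E by rewrite lee_fin; case/andP: (h01 x).
have IE : \int[mu]_(x in V) (\1_E x * h x)%:E = \int[mu]_(x in E) (h x)%:E.
  rewrite [LHS]integral_mkcond [RHS]integral_mkcond; apply: eq_integral => x _.
  rewrite !patchE indicE; have [xE|xE] := boolP (x \in E).
    by rewrite mem_set ?mul1r//; apply: EV; move: xE; rewrite inE.
  by rewrite mul0r; case: ifP.
rewrite /Rintegral IE fineK// ge0_fin_numE; last by apply: integral_ge0.
apply: (@le_lt_trans _ _ (\int[mu]_(x in E) cst 1 x)).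
  apply: ge0_le_integral => // x _.
  by rewrite lee_fin; case/andP: (h01 x).
by rewrite integral_cst// mul1e.
Qed.

(** The marginals converge weakly to 1_E, and 1_E itself is the test function. For g in C_c(V) with
    values in [0, 1], the convergence follows by duality from S(t) g -> g on E, with 1 as dominating
    function. *)
Lemma kop_indic_cvg (t_ : nat -> R) : (forall n, 0 < t_ n)%R ->
  t_ @ \oo --> (0%R : R) ->
  fine (\int[mu]_(x in E) kop (t_ n) (EFin \o \1_E) x) @[n --> \oo] --> fine (mu E).
Proof.
move=> tpos tcvg.
have mV := open_measurable_rV oV.
have C0 : (0 <= C)%R by apply: le_trans cutoff_ge1.
have H : weak_cvg mu V (fun n => cut_marginal (t_ n)) (\1_E : X -> R) (\1_E : X -> R).
  apply: (weak_cvg_sets oV Vfin C0) => //.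
  - by move=> n; exact: measurable_cut_marginal.
  - by move=> n x; exact: cut_marginal_bound.
  - by move=> x; apply: le_trans (indic_norm_le1 E x) cutoff_ge1.
  move=> g Cg g01; have [cg [A [cA AV gA]]] := Cg.
  have gV y : ~ V y -> g y = 0%R by move=> nVy; apply: gA => /AV.
  have mg := continuous_measurable_rV cg.
  have g0 y : (0 <= g y)%R by case/andP: (g01 y).
  have CgO : Cc Omega g.
    by split => //; exists A; split => //; exact: subset_trans VO.
  rewrite /weak_cvg (_ : (fun n => _) =
      fine \o (fun n => \int[mu]_(x in E) kop (t_ n) (EFin \o g) x)); last first.
    by apply/funext => n; exact: Rintegral_cut_marginal.
  apply: fine_cvg.
  have -> : (\int[mu]_(x in V) (\1_E x * g x))%R%:E = \int[mu]_(x in E) (g x)%:E.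
    exact: Rintegral_indicM.
  have mkop n : measurable_fun E (kop (t_ n) (EFin \o g)).
    apply: measurable_funTS; apply: (measurable_kop mu mker ker0 (h := fun=> t_ n) (a := id)
      (F := (EFin \o g) \o snd)) => //.
      by apply: (measurableT_comp _ measurable_snd); exact/measurable_EFinP.
    by move=> p; rewrite lee_fin; exact: g0.
  have c1 : \forall x \ae mu, E x ->
      (fun n => kop (t_ n) (EFin \o g) x) @ \oo --> (EFin \o g) x.
    by apply: aeW => x Ex; apply: (kop_Cc_cvg0 hK CgO tpos tcvg); apply: VO; exact: EV.
  have i1 : mu.-integrable E (cst 1 : X -> \bar R).
    by apply: (le_bounded_integrable mE Efin (h := cst 1%R) (B := 1%R)) => // x; rewrite normr1.
  have b1 : \forall x \ae mu, forall n, E x -> `|kop (t_ n) (EFin \o g) x| <= cst 1 x.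
    apply: aeW => x n _; rewrite gee0_abs ?kop_le1//.
    by apply: integral_ge0 => y _; rewrite mule_ge0 ?ker0// lee_fin.
  have mgE : measurable_fun E (EFin \o g) by apply: measurable_funTS; exact/measurable_EFinP.
  by have [_ _] := dominated_convergence mE mkop mgE c1 i1 b1.
have -> : fine (mu E) = (\int[mu]_(x in V) (\1_E x * \1_E x))%R.
  rewrite -[RHS]/(fine (EFin _)) Rintegral_indicM//; last first.
    by move=> y; rewrite indicE; case: (_ \in _); rewrite /= ?lexx ?ler01.
  by congr fine; rewrite integral_indic// setIid.
move: H; rewrite /weak_cvg; apply: cvg_trans; apply: near_eq_cvg; near=> n.
apply: Rintegral_cut_marginal => //.
by move=> y nVy; rewrite indicE memNset// => /EV.
Unshelve. all: by end_near. Qed.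

End small_time.

(** * The existence time *)

Section lower_bound.
Context {R : realType} {N : nat}.
Local Notation mu := (lebesgue_rV R N).
Local Notation X := 'rV[R]_N.
Variables (Omega : set X) (K : R -> X -> X -> R).
Hypotheses (oO : open Omega) (hK : dirichlet_heat_kernel Omega K).
Local Notation ker := (ker Omega K).
Local Notation kop := (kop mu ker).
Let mker := measurable_ker oO hK.
Let ker0 := ker_ge0 hK.
Local Open Scope ereal_scope.

(** Otherwise S(t_n) 1_E <= theta almost everywhere along some t_n tending to 0, and the integrals
    over E, at most theta |E|, could not tend to |E|. *)
Lemma small_time_indic (E V : set X) (theta : R) : measurable E -> open V ->
  E `<=` V -> V `<=` Omega -> mu V < +oo -> 0 < mu E -> (0 <= theta < 1)%R ->
  exists2 t0 : R, (0 < t0)%R & forall t, (0 < t < t0)%R ->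
    ~ (\forall x \ae mu, kop t (EFin \o \1_E) x <= theta%:E).
Proof.
move=> mE oV EV VO Vfin E0 /andP[th0 th1]; apply: contrapT => nex.
have Efin : mu E < +oo.
  apply: le_lt_trans Vfin; apply: le_measure => //; rewrite inE//.
  exact: open_measurable_rV.
have /choice[t_ t_P] : forall n : nat, exists t : R, (0 < t < n.+1%:R^-1)%R /\
    (\forall x \ae mu, kop t (EFin \o \1_E) x <= theta%:E).
  move=> n; apply: contrapT => nt; apply: nex; exists n.+1%:R^-1%R => // t tn H.
  by apply: nt; exists t.
have tpos n : (0 < t_ n)%R by have [/andP[]] := t_P n.
have tcvg : t_ @ \oo --> (0%R : R).
  apply: (@squeeze_cvgr _ _ _ _ (fun=> 0%R) (fun n => n.+1%:R^-1%R)).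
  - by apply: nearW => n; have [/andP[/ltW -> /ltW ->]] := t_P n.
  - exact: cvg_cst.
  - exact: cvg_harmonic.
have := kop_indic_cvg oO hK mE oV EV VO Vfin tpos tcvg.
move=> /(cvgr_to_le (b := (theta * fine (mu E))%R)) => H.
have : (fine (mu E) <= theta * fine (mu E))%R.
  apply: H; apply: nearW => n.
  have mkE : measurable_fun E (kop (t_ n) (EFin \o \1_E)).
    apply: measurable_funTS; apply: (measurable_kop mu mker ker0 (h := fun=> t_ n) (a := id)
      (F := (EFin \o \1_E) \o snd)) => //.
      apply: (measurableT_comp _ measurable_snd); apply/measurable_EFinP.
      exact: measurable_indic.
    by move=> p; rewrite lee_fin.
  have k0 x : 0 <= kop (t_ n) (EFin \o \1_E) x.
    by apply: integral_ge0 => y _; rewrite mule_ge0 ?ker0// lee_fin.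
  have le : \int[mu]_(x in E) kop (t_ n) (EFin \o \1_E) x <= theta%:E * mu E.
    rewrite -integral_cst//; apply: ae_ge0_le_integral => //.
    by have [_] := t_P n; apply: (@filterS _ _ (ae_filter_ringOfSetsType _)) => x Hx _.
  have muE : mu E \is a fin_num by rewrite ge0_fin_numE.
  rewrite -lee_fin EFinM (fineK muE) fineK// ge0_fin_numE; last exact: integral_ge0.
  by apply: le_lt_trans le _; rewrite -(fineK muE) -EFinM ltry.
have : (0 < fine (mu E))%R by rewrite fine_gt0// E0.
by nra.
Qed.

(** Transfer of [weissler_bound] to Omega: the solution and the datum are extended by 0, and the
    datum, nonnegative only almost everywhere, is replaced by its positive part; neither change
    affects the integrals against the kernel. *)
Lemma solution_bound (alpha T : R) (u0 : X -> R) (u : R -> X -> \bar R) :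
  (0 < alpha)%R -> measurable_fun Omega u0 ->
  (\forall x \ae mu, Omega x -> (0 <= u0 x)%R) ->
  integral_solution Omega K alpha u0 T u ->
  \forall t \ae (@lebesgue_measure R), \forall x \ae mu, (0 < t < T)%R ->
    let v := kop t ((EFin \o (fun y => Num.max 0 (u0 y))%R) \_ Omega) x in
    v \is a fin_num /\ (alpha * t * fine v `^ alpha <= 1)%R.
Proof.
move=> al0 mu0 u00 [mu_ u_ge0 ufin ueq].
have mO := open_measurable_rV oO.
pose Q : set (measurableTypeR R * X) := `]0%R, T[ `*` Omega.
have mQ : measurable Q by apply: measurableX => //; exact: measurable_itv.
pose u0' := (EFin \o (fun y => Num.max 0 (u0 y))%R) \_ Omega.
pose u' (r : R) (y : X) : \bar R := ((fun p : measurableTypeR R * X => u p.1 p.2) \_ Q) (r, y).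
have u'E r y : (0 < r < T)%R -> Omega y -> u' r y = u r y.
  by move=> rT Oy; rewrite /u' patchE mem_set//; split; rewrite //= in_itv.
have u'0 r y : ~ Omega y -> u' r y = 0.
  by move=> nO; rewrite /u' patchE memNset// => -[].
have mu0' : measurable_fun setT u0'.
  apply/(measurable_restrictT _ mO); apply/measurable_EFinP.
  by apply: measurable_maxr => //.
have u0'0 y : 0 <= u0' y.
  by apply: erestrict_ge0 => // z _; rewrite lee_fin le_max lexx.
have mu' : measurable_fun setT (fun q : measurableTypeR R * X => u' q.1 q.2).
  have := (measurable_restrictT _ mQ).1 mu_.
  by apply: eq_measurable_fun => -[r y] _.
have u'_ge0 r y : 0 <= u' r y.
  by rewrite /u'; apply: erestrict_ge0 => // p; exact: u_ge0.
pose lebmu := (@lebesgue_measure R \x mu).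
have ufin' : \forall p \ae lebmu, (0 < p.1 < T)%R -> u' p.1 p.2 \is a fin_num.
  apply: (@filterS _ _ (ae_filter_ringOfSetsType lebmu)) ufin => -[t x] /= H tT.
  have [Ox|nO] := pselect (Omega x); last by rewrite u'0.
  by rewrite u'E//; apply: H; split => //=; rewrite in_itv.
have ueq' : \forall p \ae lebmu, (0 < p.1 < T)%R -> u' p.1 p.2 =
     kop p.1 u0' p.2 + \int[@lebesgue_measure R]_(s in `]0%R, p.1[)
       kop (p.1 - s) (fun y => `|u' s y| `^ alpha * u' s y) p.2.
  apply: (@filterS _ _ (ae_filter_ringOfSetsType lebmu)) ueq => -[t x] /= H tT.
  have [Ox|nO] := pselect (Omega x); last first.
    rewrite u'0// kop_outl// add0e; under eq_integral do rewrite kop_outl//.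
    by rewrite integral0.
  have /andP[t0 _] := tT.
  rewrite u'E// H; last by split => //=; rewrite in_itv.
  congr (_ + _).
    rewrite -heat_op_ker// /heat_op.
    have mKx : measurable_fun Omega (fun y => (K t x y)%:E).
      have := measurable_kx mker t x => /(measurable_funTS (D := Omega)).
      by apply: eq_measurable_fun => y; rewrite inE => Oy; rewrite kerE.
    have mu0E : measurable_fun Omega (EFin \o u0) by exact/measurable_EFinP.
    apply: ae_eq_integral => //.
    - exact: emeasurable_funM.
    - by apply: emeasurable_funM => //; exact: measurable_funTS.
    apply: (@filterS _ _ (ae_filter_ringOfSetsType _)) u00 => y Hy Oy.
    by rewrite /u0' patchE mem_set//= max_r// Hy.
  rewrite /duhamel; apply: eq_integral => s; rewrite inE /= in_itv/= => /andP[s0 st].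
  have sT : (0 < s < T)%R by rewrite s0 (lt_trans st)//; case/andP: tT.
  rewrite heat_op_ker ?subr_gt0//; apply: eq_integral => y _.
  have [Oy|nOy] := pselect (Omega y); first by rewrite u'E.
  by rewrite (ker_outr _ _ _ nOy) !mul0e.
have := weissler_bound mker ker0 (ker_le1 oO hK) (kerD hK) al0 mu0' u0'0 mu' u'_ge0 ufin' ueq'.
move=> /ae_xsection; apply: (@filterS _ _ (ae_filter_ringOfSetsType _)) => t.
by apply: (@filterS _ _ (ae_filter_ringOfSetsType _)) => x.
Qed.

(* With M = m theta, the solution bound forces e^{t Delta} u0 <= M for t in
   ]1 / (alpha M^alpha), T[, hence e^{t Delta} 1_E <= theta. *)
Lemma existence_time_bound (alpha T m theta t0 : R) (E : set X) (u0 : X -> R)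
    (u : R -> X -> \bar R) :
  (0 < alpha)%R -> (0 < m)%R -> (0 < theta)%R -> (0 < t0)%R -> measurable E ->
  E `<=` Omega -> (forall x, E x -> m <= u0 x)%R ->
  (forall t, (0 < t < t0)%R ->
    ~ (\forall x \ae mu, kop t (EFin \o \1_E) x <= theta%:E)) ->
  measurable_fun Omega u0 ->
  (\forall x \ae mu, Omega x -> (0 <= u0 x)%R) ->
  integral_solution Omega K alpha u0 T u ->
  (Num.min T t0 <= (alpha * (m * theta) `^ alpha)^-1)%R.
Proof.
move=> al0 m0 th0 t00 mE EO mu0E Ht0 mu0 u00 solu; rewrite leNgt; apply/negP => cT.
set c := (_^-1)%R in cT; set tau := Num.min T t0 in cT.
have mth0 : (0 < (m * theta) `^ alpha)%R by rewrite powR_gt0// mulr_gt0.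
have c0 : (0 < c)%R by rewrite invr_gt0 mulr_gt0.
have := solution_bound al0 mu0 u00 solu.
set v0 := (_ \_ Omega) => -[A [mA A0 HA]].
(* The exceptional times form a null set, whereas ]c, tau[ has positive length. *)
have [t /andP[ct ttau] nAt] : exists2 t : R, (c < t < tau)%R & ~ A t.
  apply: contrapT => nex.
  have sub : `]c, tau[ `<=` A.
    by move=> t; rewrite /= in_itv/= => ctt; apply: contrapT => nA; apply: nex; exists t.
  have : @lebesgue_measure R `]c, tau[%classic <= 0.
    by rewrite -A0; apply: le_measure => //; rewrite inE//; exact: measurable_itv.
  by rewrite lebesgue_measure_itv/= lte_fin cT -EFinB lee_fin leNgt subr_gt0 cT.
have t_gt0 : (0 < t)%R by exact: lt_trans ct.
have [tT tt0] : (t < T /\ t < t0)%R.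
  by move: ttau; rewrite /tau lt_min => /andP[].
have := contrapT (fun nP => nAt (HA t nP)).
move=> /= Hv; have tTT : (0 < t < T)%R by rewrite t_gt0.
apply: (Ht0 t); first by rewrite t_gt0.
apply: (@filterS _ _ (ae_filter_ringOfSetsType _)) Hv => x /(_ tTT)[vfin vle].
have mkx : measurable_fun setT (ker t x) by exact: (measurable_kx mker).
have mE1 : measurable_fun setT (EFin \o (\1_E : X -> R)).
  by apply/measurable_EFinP; exact: measurable_indic.
have v00 y : 0 <= v0 y.
  by apply: erestrict_ge0 => // z _; rewrite lee_fin le_max lexx.
have mv0 : measurable_fun setT v0.
  apply/(measurable_restrictT _ (open_measurable_rV oO)); apply/measurable_EFinP.
  exact: measurable_maxr.
have mkv : m%:E * kop t (EFin \o \1_E) x <= kop t v0 x.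
  rewrite /kop -ge0_integralZl//; last 3 first.
  - exact: emeasurable_funM.
  - by move=> y _; rewrite mule_ge0 ?ker0// lee_fin.
  - by rewrite lee_fin ltW.
  apply: ge0_le_integral => //.
  - by move=> y _; rewrite !mule_ge0 ?ker0// lee_fin// ltW.
  - by apply: measurable_funeM; exact: emeasurable_funM.
  - exact: emeasurable_funM.
  - move=> y _; rewrite muleCA lee_wpmul2l ?ker0//= indicE.
    have [yE|yE] := boolP (y \in E); last by rewrite mule0.
    rewrite mule1 /v0 patchE mem_set; last by apply: EO; move: yE; rewrite inE.
    by rewrite lee_fin le_max mu0E ?orbT//; move: yE; rewrite inE.
rewrite leNgt; apply/negP => thk.
have mv : (m * theta <= fine (kop t v0 x))%R.
  rewrite -lee_fin fineK//; apply: le_trans mkv; rewrite EFinM.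
  by rewrite lee_wpmul2l ?lee_fin ?(ltW m0)// ltW.
have : (alpha * t * (m * theta) `^ alpha <= 1)%R.
  apply: le_trans vle; rewrite ler_wpM2l ?mulr_ge0 ?(ltW al0) ?(ltW t_gt0)//.
  have mt0 : (0 <= m * theta)%R by rewrite mulr_ge0 ?ltW.
  apply: (ge0_ler_powR (ltW al0) _ _ mv); rewrite nnegrE//.
  exact: le_trans mt0 mv.
apply/negP; rewrite -ltNge mulrAC mulrC.
by move: ct; rewrite /c -div1r ltr_pdivrMr ?mulr_gt0.
Qed.

End lower_bound.

(** * Superlevel sets of the datum and the limit in lambda *)

Section main.
Context {R : realType} {N : nat}.
Local Notation mu := (lebesgue_rV R N).
Local Notation X := 'rV[R]_N.

(** The ball is a cube for the maximum norm, and a Gaussian of finite mass with half-widths r is at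
    least 1 on it. *)
Lemma ball_finite_measure (r : R) : 0 < r -> (mu (ball (0%R : X) r) < +oo)%E.
Proof.
move=> r0; pose m (i : 'I_N) : R := 0; pose d (i : 'I_N) := r.
have mB : measurable (ball (0 : X) r) by apply: open_measurable_rV; exact: ball_open.
apply: (@le_lt_trans _ _ (\int[mu]_x (gauss m d 0 x)%:E)%E); last first.
  by rewrite integral_gauss// ltry.
rewrite -[ball _ _]setIT -integral_indic//.
apply: ge0_le_integral => //.
- by apply/measurable_EFinP; exact: measurable_indic.
- by apply/measurable_EFinP; exact: measurable_gauss.
move=> x _; rewrite lee_fin indicE; have [xB|_] := boolP (x \in _); last exact: expR_ge0.
apply: gauss0_ge1 => // i; rewrite /m /d subr0; move: xB; rewrite inE -ball_normE/= sub0r normrN.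
move=> /ltW; apply: le_trans; rewrite {2}/Num.norm/= mx_normrE.
exact: (le_bigmax _ (fun ij : 'I_1 * 'I_N => `|x ij.1 ij.2|) (ord0, i)).
Qed.

Variables (Omega : set X) (phi : X -> R).
Hypotheses (oO : open Omega) (mphi : measurable_fun Omega phi)
  (phi_Linf : (Linf_norm Omega phi < +oo)%E)
  (phi_ge0 : \forall x \ae mu, Omega x -> 0 <= phi x)
  (phi_neq0 : ~ (\forall x \ae mu, Omega x -> phi x = 0)).
Local Notation L := (fine (Linf_norm Omega phi)).

(** The norm takes a default value when the whole space is null; then phi would vanish almost
    everywhere. *)
Lemma Linf_norm_ess_sup :
  Linf_norm Omega phi = ess_sup mu (abse \o ((EFin \o phi) \_ Omega)).
Proof.
rewrite /Linf_norm unlock ifT// lt0e measure_ge0 andbT; apply/eqP => mu0.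
by apply: phi_neq0; exact: measure0_ae.
Qed.

Lemma Linf_norm_leP (m : R) : 0 <= m -> (Linf_norm Omega phi <= m%:E)%E ->
  \forall x \ae mu, Omega x -> phi x <= m.
Proof.
move=> m0; rewrite Linf_norm_ess_sup => /ess_supP.
apply: (@filterS _ _ (ae_filter_ringOfSetsType _)) => x /= H Ox; move: H.
by rewrite patchE mem_set//= lee_fin; apply: le_trans; exact: ler_norm.
Qed.

Lemma Linf_norm_fin : Linf_norm Omega phi \is a fin_num.
Proof. by rewrite ge0_fin_numE// Lnorm_ge0. Qed.

Lemma Linf_norm_gt0 : 0 < L.
Proof.
rewrite ltNge; apply/negP => L0; apply: phi_neq0.
have := @Linf_norm_leP 0 (lexx 0); rewrite -(fineK Linf_norm_fin) lee_fin => /(_ L0).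
apply: (@filterS2 _ _ (ae_filter_ringOfSetsType _)) phi_ge0 => x H1 H2 Ox.
by apply/eqP; rewrite eq_le H2// H1.
Qed.

(** If every bounded part of the set where phi > m were null, the norm would be at most m. Cutting
    with a ball provides the finite measure of [V]. *)
Lemma superlevel_set (m : R) : 0 <= m < L -> exists E V : set X,
  [/\ measurable E, open V /\ E `<=` V, V `<=` Omega /\ (mu V < +oo)%E,
      (0 < mu E)%E & forall x, E x -> m <= phi x].
Proof.
move=> /andP[m0 mL]; have mO := open_measurable_rV oO.
pose E n := (Omega `&` phi @^-1` `]m, +oo[) `&` ball (0 : X) n.+1%:R.
have mE n : measurable (E n).
  apply: measurableI; first by apply: mphi => //; exact: measurable_itv.
  by apply: open_measurable_rV; exact: ball_open.
have [n En] : exists n, (0 < mu (E n))%E.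
  apply: contrapT => nE.
  have E0 n : mu (E n) = 0%E.
    by apply/eqP; rewrite -measure_le0 leNgt; apply/negP => En; apply: nE; exists n.
  suff : (Linf_norm Omega phi <= m%:E)%E.
    by rewrite -(fineK Linf_norm_fin) lee_fin leNgt mL.
  rewrite Linf_norm_ess_sup; apply/ess_supP.
  have : \forall x \ae mu, forall n, ~ E n x.
    apply: ae_foralln => n; exists (E n); split => //; first exact: E0.
    by move=> x /= /contrapT.
  apply: (@filterS2 _ _ (ae_filter_ringOfSetsType _)) phi_ge0 => x H1 H2.
  rewrite /= patchE; case: ifPn => [|_]; last by rewrite abse0 lee_fin.
  rewrite inE => Ox /=; rewrite lee_fin ger0_norm ?H1// leNgt; apply/negP => mx.
  apply: (H2 (Num.truncn `|x|)); split.
    by split => //=; rewrite in_itv/= mx.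
  by rewrite -ball_normE/= sub0r normrN truncnS_gt.
exists (E n), (Omega `&` ball (0 : X) n.+1%:R); split => //.
- by split; [apply: openI => //; exact: ball_open|move=> x [[Ox _] xn]; split].
- split; first exact: subIsetl.
  apply: le_lt_trans (ball_finite_measure (ltr0Sn R n)).
  apply: le_measure; [rewrite inE|rewrite inE|exact: subIsetr].
    by apply: open_measurable_rV; apply: openI => //; exact: ball_open.
  by apply: open_measurable_rV; exact: ball_open.
- by move=> x [[_ /=]]; rewrite in_itv/= andbT => /ltW.
Qed.

Variables (K : R -> X -> X -> R) (alpha : R).
Hypotheses (hK : dirichlet_heat_kernel Omega K) (alpha_gt0 : 0 < alpha).

Lemma Tmax_le (rho : R) : 0 < rho < 1 -> \forall lambda \near +oo%R,
  (Tmax Omega K alpha (fun x => (lambda : R) * phi x)%R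
   <= ((alpha * (lambda * (L * rho)) `^ alpha)^-1)%:E)%E.
Proof.
move=> /andP[rho0 rho1].
(* The loss rho is split evenly: one factor q for the level L * q of phi on E, the other for the
   level theta = q exceeded by S(t) 1_E. *)
pose q := Num.sqrt rho.
have q0 : 0 < q by rewrite sqrtr_gt0.
have q1 : q < 1 by rewrite -sqrtr1 ltr_sqrt.
have qq : q * q = rho by rewrite -expr2 sqr_sqrtr// ltW.
have L0 := Linf_norm_gt0.
have [|E [V [mE [oV EV] [VO Vfin] E0 mphiE]]] := @superlevel_set (L * q).
  by rewrite mulr_ge0 ?ltW//= gtr_pMr.
have q01 : 0 <= q < 1 by rewrite ltW.
have [t0 t00 Ht0] := small_time_indic oO hK mE oV EV VO Vfin E0 q01.
(* Once lambda * L * rho exceeds s, the claimed bound is smaller than t0, so the minimum in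
   [existence_time_bound] has to be T. *)
pose s := (alpha * t0)^-1 `^ alpha^-1.
have Lr0 : 0 < L * rho by rewrite mulr_gt0.
near=> lambda.
have lam0 : 0 < lambda by near: lambda; exact: nbhs_pinfty_gt.
have slam : s < lambda * (L * rho).
  rewrite -ltr_pdivrMr//; near: lambda; apply: nbhs_pinfty_gt; exact: num_real.
have s0 : 0 <= s by exact: powR_ge0.
have al_t0 : 0 < (alpha * t0)^-1 by rewrite invr_gt0 mulr_gt0.
have slam' : (alpha * t0)^-1 < (lambda * (L * rho)) `^ alpha.
  rewrite -[ltLHS]powRr1 ?(ltW al_t0)// -(mulVf (lt0r_neq0 alpha_gt0)) powRrM.
  by apply: gt0_ltr_powR => //; rewrite nnegrE// ltW// (le_lt_trans s0).
have c_t0 : (alpha * (lambda * (L * rho)) `^ alpha)^-1 < t0.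
  have aP : 0 < alpha * (lambda * (L * rho)) `^ alpha.
    by rewrite mulr_gt0 ?powR_gt0// mulr_gt0.
  rewrite -div1r ltr_pdivrMr//; move: slam'; rewrite -div1r ltr_pdivrMr ?mulr_gt0//.
  by set P := _ `^ alpha; rewrite (_ : t0 * (alpha * P) = P * (alpha * t0))//; ring.
rewrite /Tmax ge_max; apply/andP; split.
  by rewrite lee_fin invr_ge0 mulr_ge0 ?powR_ge0// ltW.
apply: ge_ereal_sup => _ [T [T0 [u solu]] <-]; rewrite lee_fin.
have mlphi : measurable_fun Omega (fun x => lambda * phi x) by exact: measurable_funM.
have lphi0 : \forall x \ae mu, Omega x -> 0 <= lambda * phi x.
  apply: (@filterS _ _ (ae_filter_ringOfSetsType _)) phi_ge0 => x H Ox.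
  by rewrite mulr_ge0 ?(ltW lam0)// H.
have := existence_time_bound oO hK alpha_gt0 (mulr_gt0 lam0 (mulr_gt0 L0 q0)) q0 t00 mE
  (subset_trans EV VO) _ Ht0 mlphi lphi0 solu.
have -> : lambda * (L * q) * q = lambda * (L * rho) by rewrite -qq !mulrA.
move=> H; have {}H : Num.min T t0 <= (alpha * (lambda * (L * rho)) `^ alpha)^-1.
  by apply: H => x Ex; rewrite ler_pM2l// mphiE.
by move: H; rewrite ge_min => /orP[//|]; rewrite leNgt c_t0.
Unshelve. all: by end_near. Qed.

End main.

Theorem theorem1p6 (R : realType) (N : nat) (hN : (1 <= N)%N)
    (alpha : R) (halpha : 0 < alpha)
    (Omega : set 'rV[R]_N) (hOmega : domain Omega) (hbd : C1_boundary Omega)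
    (K : R -> 'rV[R]_N -> 'rV[R]_N -> R) (hK : dirichlet_heat_kernel Omega K)
    (phi : 'rV[R]_N -> R) (mphi : measurable_fun Omega phi)
    (phi_Linf : (Linf_norm Omega phi < +oo)%E)
    (phi_ge0 : \forall x \ae lebesgue_rV R N, Omega x -> 0 <= phi x)
    (phi_neq0 : ~ (\forall x \ae lebesgue_rV R N, Omega x -> phi x = 0)) :
  (\forall lambda \near +oo%R,
     (Tmax Omega K alpha (fun x => (lambda : R) * phi x)%R < +oo)%E) /\
  (limf_esup (fun lambda : R =>
      (lambda `^ alpha)%:E * Tmax Omega K alpha (fun x => (lambda * phi x)%R))
     (pinfty_nbhs R)
   <= ((alpha * fine (Linf_norm Omega phi) `^ alpha)^-1)%:E)%E.
Proof.
have [oO _ _] := hOmega.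
have bound rho := Tmax_le oO mphi phi_Linf phi_ge0 phi_neq0 hK halpha (rho := rho).
have L0 := Linf_norm_gt0 phi_Linf phi_ge0 phi_neq0.
set L := fine _ in bound L0 *.
split.
  have h : 0 < (2^-1 : R) < 1 by rewrite invr_gt0 ltr0n invf_lt1 ?ltr1n.
  apply: filterS (bound _ h) => lambda H.
  by apply: le_lt_trans H _; rewrite ltry.
set B := (_ * _)^-1.
have B0 : 0 < B by rewrite invr_gt0 mulr_gt0// powR_gt0.
apply/lee_addgt0Pr => e e0; pose B' := B + e.
have B'0 : 0 < B' by rewrite addr_gt0.
have BB' : 0 < B / B' by rewrite divr_gt0.
(* This ratio makes the bound [Tmax_le] equal to [B'] at [rho]. *)
pose rho := (B / B') `^ alpha^-1.
have rho_al : rho `^ alpha = B / B'.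
  by rewrite -powRrM mulVf ?gt_eqF// powRr1// ltW.
have rho01 : 0 < rho < 1.
  have one : 1 `^ alpha^-1 = 1 :> R by rewrite powR1.
  rewrite powR_gt0//= -[ltRHS]one; apply: gt0_ltr_powR; rewrite ?invr_gt0 ?nnegrE ?ltW//.
  by rewrite ltr_pdivrMr// mul1r ltrDl.
rewrite -EFinD -/B'; pose A := [set lambda : R | 0 < lambda /\
  (Tmax Omega K alpha (fun x => lambda * phi x)%R
    <= ((alpha * (lambda * (L * rho)) `^ alpha)^-1)%:E)%E].
have FA : pinfty_nbhs R A.
  by apply: filterI; [exact: nbhs_pinfty_gt|exact: bound].
(* The upper limit is an infimum over neighbourhoods of infinity, so the supremum over the single
   set [A] bounds it. *)
apply: (@le_trans _ _ (ereal_sup [set ((lambda `^ alpha)%:E *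
    Tmax Omega K alpha (fun x => (lambda * phi x)%R))%E | lambda in A])).
  by apply: ereal_inf_lbound; exists A.
apply: ge_ereal_sup => _ [lambda [lam0 lamT] <-].
have lal : 0 < lambda `^ alpha by rewrite powR_gt0.
have Lal : 0 < L `^ alpha by rewrite powR_gt0.
apply: (@le_trans _ _ ((lambda `^ alpha)%:E *
    ((alpha * (lambda * (L * rho)) `^ alpha)^-1)%:E)%E).
  by apply: lee_wpmul2l => //; rewrite lee_fin ltW.
have /andP[rho0 _] := rho01.
(* By homogeneity lambda^alpha cancels and leaves B / rho^alpha = B'. *)
rewrite -EFinM lee_fin !powRM ?mulr_ge0 ?(ltW lam0) ?(ltW L0) ?(ltW rho0)// rho_al.
rewrite le_eqVlt; apply/orP; left; apply/eqP; rewrite /B.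
by field; rewrite !gt_eqF.
Qed.
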